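(* Let $\mathscr{C}$ be a semi-abelian category. Then the category $2\text{-}\mathrm{Grpd}(\mathscr{C})$ of internal $2$-groupoids in $\mathscr{C}$ is a semi-abelian category.
   Context: Semi-abelian category: a category that is pointed, exact (in the sense of Barr), protomodular and has binary coproducts. Exact: finitely complete, with coequalizers of kernel pairs, pullback-stable regular epimorphisms, and every internal equivalence relation is a kernel pair. In this context protomodularity is equivalent to the Split Short Five Lemma: given split epimorphisms $p\colon B\to C$, $p'\colon B'\to C$ with sections $s,s'$ ($ps=1_C$, $p's'=1_C$), kernels $k\colon A\to B$ of $p$ and $k'\colon A\to B'$ of $p'$, and $b\colon B\to B'$ with $bk=k'$, $p'b=p$, $bs=s'$, the morphism $b$ is an isomorphism. Internal groupoids: $\mathrm{Grpd}(\mathscr{C})$ is the category of internal groupoids in $\mathscr{C}$ and internal functors. An internal groupoid consists of a reflexive graph $d,c\colon C_1\to C_0$, $e\colon C_0\to C_1$ with $de=1_{C_0}=ce$, together with a composition $m\colon C_1\times_{C_0}C_1\to C_1$ and an inverse $i\colon C_1\to C_1$ satisfying the usual axioms. Double groupoids: $\mathrm{Grpd}^2(\mathscr{C}):=\mathrm{Grpd}(\mathrm{Grpd}(\mathscr{C}))$. A double groupoid has an underlying double reflexive graph: objects $C^i_j$ ($i,j\in\{0,1\}$), horizontal reflexive graphs $d^i,c^i\colon C^i_1\to C^i_0$, $e^i\colon C^i_0\to C^i_1$, and vertical reflexive graphs $d_j,c_j\colon C^1_j\to C^0_j$, $e_j\colon C^0_j\to C^1_j$, with the horizontal and vertical structures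 commuting with each other; each of these underlies an internal groupoid. $2\text{-}\mathrm{Grpd}(\mathscr{C})$ is the full subcategory of $\mathrm{Grpd}^2(\mathscr{C})$ whose objects are the double groupoids for which $e^0\colon C^0_0\to C^0_1$ is an isomorphism. *)

(* Defs.v *)
From mathcomp Require Import all_boot.
From mathcomp Require Import boolp.

Set Implicit Arguments.
Unset Strict Implicit.
Unset Printing Implicit Defensive.

Declare Scope cat_scope.
Delimit Scope cat_scope with cat.
Local Open Scope cat_scope.

Record category := Category {
  ob :> Type;
  hom : ob -> ob -> Type;
  idm : forall A, hom A A;
  compm : forall A B C, hom B C -> hom A B -> hom A C;
  compm_idl : forall A B (f : hom A B), compm (idm B) f = f;
  compm_idr : forall A B (f : hom A B), compm f (idm A) = f;
  compmA : forall A B C D (h : hom C D) (g : hom B C) (f : hom A B),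
    compm h (compm g f) = compm (compm h g) f
}.

Arguments hom {c} A B.
Arguments idm {c} A.
Arguments compm {c A B C} g f.

Notation "g ∘ f" := (compm g f) (at level 40, left associativity) : cat_scope.

(* Limits of finite diagrams; a diagram is given on a finite directed graph,
   the cones over a functor from a finite category being the cones over the
   diagram on its underlying graph. *)
Record graph := Graph {
  vertex : finType;
  edge : finType;
  src : edge -> vertex;
  tgt : edge -> vertex
}.

Record diagram (Q : graph) (C : category) := Diagram {
  dob : vertex Q -> C;
  dmor : forall e : edge Q, hom (dob (src e)) (dob (tgt e))
}.

Section Notions.
Variable C : category.
Implicit Types A B X Y Z : C.

Definition is_iso A B (f : hom A B) :=
  exists g : hom B A, g ∘ f = idm A /\ f ∘ g = idm B.

Definition is_cone (Q : graph) (D : diagram Q C) X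
    (t : forall v, hom X (dob D v)) :=
  forall e : edge Q, dmor D e ∘ t (src e) = t (tgt e).

Definition is_limit (Q : graph) (D : diagram Q C) X
    (t : forall v, hom X (dob D v)) :=
  is_cone t /\
  forall Y (s : forall v, hom Y (dob D v)), is_cone s ->
    exists! u : hom Y X, forall v, t v ∘ u = s v.

Definition finitely_complete :=
  forall (Q : graph) (D : diagram Q C),
    exists X (t : forall v, hom X (dob D v)), is_limit t.

Definition is_zero_object Z :=
  (forall X, exists! f : hom Z X, True) /\
  (forall X, exists! f : hom X Z, True).

Definition pointed := exists Z, is_zero_object Z.

Definition is_zero_morphism A B (f : hom A B) :=
  exists Z (b : hom Z B) (a : hom A Z), is_zero_object Z /\ f = b ∘ a.

Definition is_coproduct A B S (i : hom A S) (j : hom B S) :=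
  forall X (f : hom A X) (g : hom B X),
    exists! u : hom S X, u ∘ i = f /\ u ∘ j = g.

Definition has_binary_coproducts :=
  forall A B, exists S (i : hom A S) (j : hom B S), is_coproduct i j.

Definition is_pullback A B Y P (f : hom A Y) (g : hom B Y)
    (p : hom P A) (q : hom P B) :=
  f ∘ p = g ∘ q /\
  forall X (a : hom X A) (b : hom X B), f ∘ a = g ∘ b ->
    exists! u : hom X P, p ∘ u = a /\ q ∘ u = b.

Definition is_kernel_pair A B R (f : hom A B) (r1 r2 : hom R A) :=
  is_pullback f f r1 r2.

Definition is_coequalizer A B Y (f g : hom A B) (q : hom B Y) :=
  q ∘ f = q ∘ g /\
  forall X (h : hom B X), h ∘ f = h ∘ g -> exists! u : hom Y X, u ∘ q = h.

Definition is_regular_epi B Y (q : hom B Y) :=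
  exists A (f g : hom A B), is_coequalizer f g q.

Definition has_coequalizers_of_kernel_pairs :=
  forall A B R (f : hom A B) (r1 r2 : hom R A), is_kernel_pair f r1 r2 ->
    exists Y (q : hom A Y), is_coequalizer r1 r2 q.

Definition regular_epis_pullback_stable :=
  forall A B Y P (f : hom A Y) (g : hom B Y) (p : hom P A) (q : hom P B),
    is_pullback f g p q -> is_regular_epi f -> is_regular_epi q.

Definition is_equivalence_relation A R (r1 r2 : hom R A) :=
  [/\ forall X (u v : hom X R), r1 ∘ u = r1 ∘ v -> r2 ∘ u = r2 ∘ v -> u = v,
      exists e : hom A R, r1 ∘ e = idm A /\ r2 ∘ e = idm A,
      exists s : hom R R, r1 ∘ s = r2 /\ r2 ∘ s = r1
    & forall P (p q : hom P R), is_pullback r2 r1 p q ->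
        exists t : hom P R, r1 ∘ t = r1 ∘ p /\ r2 ∘ t = r2 ∘ q].

Definition equivalence_relations_effective :=
  forall A R (r1 r2 : hom R A), is_equivalence_relation r1 r2 ->
    exists B (f : hom A B), is_kernel_pair f r1 r2.

Definition exact :=
  [/\ finitely_complete, has_coequalizers_of_kernel_pairs,
      regular_epis_pullback_stable & equivalence_relations_effective].

(* [b] is a morphism of points (split epimorphisms with a chosen section)
   from [(p, s)] to [(p', s')] over [Y]. *)
Definition is_point_morphism B B' Y (p : hom B Y) (s : hom Y B)
    (p' : hom B' Y) (s' : hom Y B') (b : hom B B') :=
  [/\ p ∘ s = idm Y, p' ∘ s' = idm Y, p' ∘ b = p & b ∘ s = s'].

(* Bourn's definition: for every [v : E -> Y] the change-of-base functor
   Pt(Y) -> Pt(E) of the fibration of points reflects isomorphisms; [b0] is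
   the image of [b] under this functor. *)
Definition protomodular :=
  forall B B' Y E P P' (p : hom B Y) (s : hom Y B) (p' : hom B' Y)
    (s' : hom Y B') (b : hom B B') (v : hom E Y) (q : hom P B) (p0 : hom P E)
    (q' : hom P' B') (p0' : hom P' E) (b0 : hom P P'),
    is_point_morphism p s p' s' b ->
    is_pullback p v q p0 -> is_pullback p' v q' p0' ->
    q' ∘ b0 = b ∘ q -> p0' ∘ b0 = p0 ->
    is_iso b0 -> is_iso b.

Definition semi_abelian :=
  [/\ pointed, exact, protomodular & has_binary_coproducts].

Definition is_kernel A B Y (p : hom B Y) (k : hom A B) :=
  is_zero_morphism (p ∘ k) /\
  forall X (f : hom X B), is_zero_morphism (p ∘ f) ->
    exists! u : hom X A, k ∘ u = f.

Definition split_short_five :=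
  forall A B B' Y (p : hom B Y) (s : hom Y B) (p' : hom B' Y) (s' : hom Y B')
    (k : hom A B) (k' : hom A B') (b : hom B B'),
    is_point_morphism p s p' s' b -> is_kernel p k -> is_kernel p' k' ->
    b ∘ k = k' -> is_iso b.

Lemma zero_morphism_unique A B (f g : hom A B) :
  is_zero_morphism f -> is_zero_morphism g -> f = g.
Proof.
move=> [Z [b [a [[Zi Zt] ->]]]] [Z' [b' [a' [[Zi' Zt'] ->]]]].
have [t _] := Zi Z'.
have [x [_ xu]] := Zt' A; have [y [_ yu]] := Zi B.
by rewrite -(xu a') // (xu (t ∘ a)) // compmA -(yu b) // (yu (b' ∘ t)).
Qed.

Lemma zero_morphism_compr A B X (f : hom A B) (g : hom X A) :
  is_zero_morphism f -> is_zero_morphism (f ∘ g).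
Proof.
by move=> [Z [b [a [Z0 ->]]]]; exists Z, b, (a ∘ g); rewrite compmA.
Qed.

Lemma zero_morphism_compl A B X (g : hom B X) (f : hom A B) :
  is_zero_morphism f -> is_zero_morphism (g ∘ f).
Proof.
by move=> [Z [b [a [Z0 ->]]]]; exists Z, (g ∘ b), a; rewrite compmA.
Qed.

Lemma finitely_complete_pullback : finitely_complete ->
  forall A B Y (f : hom A Y) (g : hom B Y),
    exists P (p : hom P A) (q : hom P B), is_pullback f g p q.
Proof.
move=> fc A B Y f g.
pose Q := @Graph (option bool) bool Some (fun=> None).
pose D := @Diagram Q C
  (fun v => match v with None => Y | Some true => A | Some false => B end)
  (fun e : bool => match e with true => f | false => g end).
have [P [t [tc tu]]] := fc Q D.
exists P, (t (Some true)), (t (Some false)); split.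
  by rewrite (tc true) (tc false).
move=> X a b fab.
pose s (v : vertex Q) : hom X (dob D v) :=
  match v return hom X (dob D v) with
  | None => f ∘ a | Some true => a | Some false => b end.
have [|u [us uu]] := tu X s; first by case.
exists u; split; first by rewrite (us (Some true)) (us (Some false)).
move=> w [wa wb]; apply: uu => -[[]|] //.
by rewrite -(tc true) -compmA /= wa.
Qed.

Lemma protomodular_split_short_five :
  pointed -> finitely_complete -> (protomodular <-> split_short_five).
Proof.
move=> [Z Z0] fc; have [Zi Zt] := Z0; split=> [pm | ssf].
  move=> A B B' Y p s p' s' k k' b bP kP k'P bk.
  have [v _] := Zi Y; have [z [_ zu]] := Zt A.
  have ker_pb B1 (p1 : hom B1 Y) (k1 : hom A B1) :
      is_kernel p1 k1 -> is_pullback p1 v k1 z.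
    move=> [k0 ku]; split.
      by apply: zero_morphism_unique => //; exists Z, v, z.
    move=> X f g fg.
    have [|u [uf uu]] := ku X f; first by rewrite fg; exists Z, v, g.
    exists u; split=> [|w [wf _]]; last exact: uu.
    split=> //; have [y [_ yu]] := Zt X.
    by rewrite -(yu g) // (yu (z ∘ u)).
  apply: (pm _ _ _ _ _ _ _ _ _ _ _ v k z k' z (idm A) bP).
  - exact: ker_pb.
  - exact: ker_pb.
  - by rewrite compm_idr bk.
  - by rewrite compm_idr.
  - by exists (idm A); rewrite compm_idl.
move=> B B' Y E P P' p s p' s' b v q p0 q' p0' b0 bP pb pb' qb pb0 [b1 [b10 b01]].
have [_ _ p'b _] := bP.
have [v0 _] := Zi Y.
have [A [k [z [pk ku]]]] := finitely_complete_pullback fc p v0.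
have pk0 : is_zero_morphism (p ∘ k) by exists Z, v0, z.
have kP : is_kernel p k.
  split=> // X f fz.
  have [y [_ yu]] := Zt X.
  have [|u [[uf _] uu]] := ku X f y.
    by apply: zero_morphism_unique => //; exists Z, v0, y.
  exists u; split=> // w wf; apply: uu; split=> //.
  by rewrite (yu (z ∘ w)).
apply: (ssf A B B' Y p s p' s' k (b ∘ k) b bP kP _ erefl).
have [eE _] := Zi E.
have lift X (f : hom X B') : is_zero_morphism (p' ∘ f) ->
    exists w : hom X A, b ∘ k ∘ w = f.
  move=> fz; have [y _] := Zt X.
  have zz : is_zero_morphism (eE ∘ y) by exists Z, eE, y.
  have [|u [[qu pu] _]] := pb'.2 X f (eE ∘ y).
    by apply: zero_morphism_unique => //; apply: zero_morphism_compl.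
  have bu : b0 ∘ (b1 ∘ u) = u by rewrite compmA b01 compm_idl.
  have [|w [kw _]] := kP.2 X (q ∘ (b1 ∘ u)).
    rewrite compmA pb.1 -compmA; apply: zero_morphism_compl.
    by rewrite -pb0 -compmA bu pu.
  by exists w; rewrite -compmA kw compmA -qb -compmA bu.
split=> [|X f fz]; first by rewrite compmA p'b.
have [w wf] := lift X f fz; exists w; split=> // w' w'f.
have [y _] := Zt X.
have zz : is_zero_morphism (eE ∘ y) by exists Z, eE, y.
have lk (t : hom X A) : b ∘ k ∘ t = f ->
    exists a : hom X P, [/\ q ∘ a = k ∘ t, p0 ∘ a = eE ∘ y & q' ∘ (b0 ∘ a) = f].
  move=> tf; have [|a [[qa pa] _]] := pb.2 X (k ∘ t) (eE ∘ y).
    apply: zero_morphism_unique; last exact: zero_morphism_compl.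
    by rewrite compmA; apply: zero_morphism_compr.
  by exists a; split=> //; rewrite compmA qb -compmA qa compmA.
have [a [qa pa fa]] := lk w wf; have [a' [qa' pa' fa']] := lk w' w'f.
have aa' : b0 ∘ a = b0 ∘ a'.
  have [|u [_ uu]] := pb'.2 X f (eE ∘ y).
    by apply: zero_morphism_unique => //; apply: zero_morphism_compl.
  by rewrite -(uu (b0 ∘ a)) ?(uu (b0 ∘ a')) //; split=> //; rewrite compmA pb0.
have {}aa' : a = a'.
  by rewrite -(compm_idl a) -(compm_idl a') -b10 -!compmA aa'.
have [|u [_ uu]] := kP.2 X (k ∘ w).
  by rewrite compmA; apply: zero_morphism_compr.
by rewrite -(uu w) // (uu w') // -qa aa'.
Qed.

End Notions.

Section FullSubcategory.
Variables (C : category) (S : C -> Prop).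

Definition full_subcategory : category :=
  @Category {X : C | S X} (fun X Y => hom (sval X) (sval Y))
    (fun X => idm (sval X)) (fun X Y Z g f => g ∘ f)
    (fun X Y f => compm_idl f) (fun X Y f => compm_idr f)
    (fun X Y Z W h g f => compmA h g f).

End FullSubcategory.

(* Given a composition [m] on a pullback [C2] with projections [p1], [p2], the
   generalized elements [f], [g] of [C1] form a composable pair with composite
   [h]. Composites are written in diagrammatic order. *)
Definition composes (C : category) (C1 C2 X : C) (p1 p2 m : hom C2 C1)
    (f g h : hom X C1) :=
  exists u : hom X C2, [/\ p1 ∘ u = f, p2 ∘ u = g & m ∘ u = h].

(* The pullback of composable pairs is unique only up to isomorphism, so that a
   choice of it is part of the data of a groupoid. Associativity is stated on
   generalized elements. *)
Record groupoid (C : category) := Groupoid {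
  gob : C;
  garr : C;
  gpairs : C;
  gdom : hom garr gob;
  gcod : hom garr gob;
  gid : hom gob garr;
  gfst : hom gpairs garr;
  gsnd : hom gpairs garr;
  gmul : hom gpairs garr;
  ginv : hom garr garr;
  gdom_id : gdom ∘ gid = idm gob;
  gcod_id : gcod ∘ gid = idm gob;
  gpairs_pullback : is_pullback gcod gdom gfst gsnd;
  gdom_mul : gdom ∘ gmul = gdom ∘ gfst;
  gcod_mul : gcod ∘ gmul = gcod ∘ gsnd;
  gmul_idl : composes gfst gsnd gmul (gid ∘ gdom) (idm garr) (idm garr);
  gmul_idr : composes gfst gsnd gmul (idm garr) (gid ∘ gcod) (idm garr);
  gmulA : forall (X : C) (f g h fg gh k : hom X garr),
    composes gfst gsnd gmul f g fg -> composes gfst gsnd gmul g h gh ->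
    composes gfst gsnd gmul fg h k -> composes gfst gsnd gmul f gh k;
  gdom_inv : gdom ∘ ginv = gcod;
  gcod_inv : gcod ∘ ginv = gdom;
  gmul_invr : composes gfst gsnd gmul (idm garr) ginv (gid ∘ gdom);
  gmul_invl : composes gfst gsnd gmul ginv (idm garr) (gid ∘ gcod)
}.

Arguments gob {C} _.
Arguments garr {C} _.
Arguments gpairs {C} _.
Arguments gdom {C} _.
Arguments gcod {C} _.
Arguments gid {C} _.
Arguments gfst {C} _.
Arguments gsnd {C} _.
Arguments gmul {C} _.
Arguments ginv {C} _.

Record internal_functor (C : category) (G H : groupoid C) := InternalFunctor {
  fob : hom (gob G) (gob H);
  farr : hom (garr G) (garr H);
  fun_dom : gdom H ∘ farr = fob ∘ gdom G;
  fun_cod : gcod H ∘ farr = fob ∘ gcod G;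
  fun_id : farr ∘ gid G = gid H ∘ fob;
  fun_mul : composes (gfst H) (gsnd H) (gmul H)
    (farr ∘ gfst G) (farr ∘ gsnd G) (farr ∘ gmul G)
}.

Arguments fob {C G H} _.
Arguments farr {C G H} _.

Section Grpd.
Variable C : category.
Implicit Types G H K : groupoid C.

Lemma internal_functor_eq G H (F F' : internal_functor G H) :
  fob F = fob F' -> farr F = farr F' -> F = F'.
Proof.
case: F F' => [f0 f1 a b c d] [g0 g1 a' b' c' d'] /= e0 e1.
subst g0 g1; congr InternalFunctor; exact: Prop_irrelevance.
Qed.

Definition internal_functor_id G : internal_functor G G.
Proof.
exists (idm (gob G)) (idm (garr G));
  rewrite ?compm_idl ?compm_idr //.
by exists (idm _); rewrite !compm_idr.
Defined.

Definition internal_functor_comp G H K (F' : internal_functor H K)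
  (F : internal_functor G H) : internal_functor G K.
Proof.
exists (fob F' ∘ fob F) (farr F' ∘ farr F).
- by rewrite compmA fun_dom -!compmA fun_dom.
- by rewrite compmA fun_cod -!compmA fun_cod.
- by rewrite -compmA fun_id !compmA fun_id.
have [u [u1 u2 u3]] := fun_mul F; have [u' [u'1 u'2 u'3]] := fun_mul F'.
exists (u' ∘ u).
by split; rewrite compmA ?u'1 ?u'2 ?u'3 -!compmA ?u1 ?u2 ?u3.
Defined.

Definition Grpd : category.
Proof.
exists (groupoid C) (@internal_functor C) internal_functor_id
  internal_functor_comp.
- by move=> G H F; apply: internal_functor_eq => /=; rewrite compm_idl.
- by move=> G H F; apply: internal_functor_eq => /=; rewrite compm_idr.
- by move=> G H K L F'' F' F; apply: internal_functor_eq => /=; rewrite compmA.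
Defined.

End Grpd.

(* In an object [D] of [DoubleGrpd C] the outer groupoid is the horizontal
   direction: [gob D] and [garr D] are the vertical groupoids
   C^1_0 => C^0_0 and C^1_1 => C^0_1, and the internal functor
   [gid D : gob D -> garr D] has components e^0 on objects and e^1 on arrows. *)
Definition DoubleGrpd (C : category) : category := Grpd (Grpd C).

Definition horizontal_identity (C : category) (D : DoubleGrpd C) :
    hom (gob (gob D)) (gob (garr D)) :=
  fob (gid D).

Definition TwoGrpd (C : category) : category :=
  full_subcategory (fun D : DoubleGrpd C => is_iso (horizontal_identity D)).

(* Main.v *)
From mathcomp Require Import all_boot.
From mathcomp Require Import boolp.
Require Import Defs.

(** Call a reflexive graph multiplicative if its composable pairs carry an
    operation with the identities as units. In a protomodular category, the pairs
    (f, 1) and (1, g) generate the object of composable pairs: no proper subobject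
    contains both ([split_pullback_strong]). A multiplication is therefore
    unique, it is associative and compatible with domains and codomains, it has
    inverses, and it is preserved by all maps of reflexive graphs. So an internal
    groupoid is a multiplicative reflexive graph, and internal functors are maps of
    reflexive graphs ([groupoid_of_multiplication], [functor_of_graph_map]).

    A multiplication passes to finite limits, computed on objects and on arrows,
    and to levelwise quotients ([quotient_multiplication]), again because it is
    enough to look at the pairs (f, 1) and (1, g). Hence the two functors
    from Grpd(C) to C that give the objects and the arrows preserve finite limits
    and quotients by kernel pairs and jointly reflect isomorphisms, and exactness
    and protomodularity of C pass to Grpd(C) along them ([transfer_exact],
    [transfer_protomodular]). Coproducts are those of reflexive graphs, followed
    by the reflection that forces a multiplication to exist
    ([groupoid_reflection]). So Grpd(C) is semi-abelian, and then so is
    Grpd(Grpd(C)).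

    A double groupoid is a 2-groupoid exactly when the idempotent e^0 d^0 on C^0_1
    is the identity. This equation is inherited by limits and by regular
    quotients, because C^0_1 depends on the double groupoid by a functor that
    preserves limits and regular epimorphisms; this gives exactness and
    protomodularity of 2-Grpd(C). Forcing the equation gives a reflection
    of Grpd(Grpd(C)) onto 2-Grpd(C) ([two_groupoid_reflection]), and hence
    coproducts. *)

Set Implicit Arguments.
Unset Strict Implicit.
Unset Printing Implicit Defensive.

Local Open Scope cat_scope.

(** * Pullbacks, limits and coequalizers *)

Section Basics.
Variable C : category.
Implicit Types A B X Y Z N P R : C.

Definition monic N Y (n : hom N Y) :=
  forall X (a b : hom X N), n ∘ a = n ∘ b -> a = b.

Definition jointly_monic A R (r1 r2 : hom R A) :=
  forall X (u v : hom X R), r1 ∘ u = r1 ∘ v -> r2 ∘ u = r2 ∘ v -> u = v.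

Lemma comp_pre A B Y D (f : hom B Y) (g : hom A B) (f' : hom D Y) (g' : hom A D)
    X (x : hom X A) :
  f ∘ g = f' ∘ g' -> f ∘ (g ∘ x) = f' ∘ (g' ∘ x).
Proof. by move=> e; rewrite !compmA e. Qed.

Lemma comp_pre1 A B Y (f : hom B Y) (g : hom A B) h X (x : hom X A) :
  f ∘ g = h -> f ∘ (g ∘ x) = h ∘ x.
Proof. by move=> e; rewrite !compmA e. Qed.

Lemma comp_preid A B (f : hom B A) (g : hom A B) X (x : hom X A) :
  f ∘ g = idm A -> f ∘ (g ∘ x) = x.
Proof. by move=> e; rewrite !compmA e compm_idl. Qed.

Lemma is_iso_id A : is_iso (idm A).
Proof. by exists (idm A); rewrite compm_idl. Qed.

Lemma pullback_lift A B Y P (f : hom A Y) (g : hom B Y) (p : hom P A)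
    (q : hom P B) X (a : hom X A) (b : hom X B) :
  is_pullback f g p q -> f ∘ a = g ∘ b ->
  exists u : hom X P, p ∘ u = a /\ q ∘ u = b.
Proof. by move=> [_ pbu] /pbu [u [? _]]; exists u. Qed.

Lemma pullback_ext A B Y P (f : hom A Y) (g : hom B Y) (p : hom P A)
    (q : hom P B) X (u v : hom X P) :
  is_pullback f g p q -> p ∘ u = p ∘ v -> q ∘ u = q ∘ v -> u = v.
Proof.
move=> [pbc pbu] pe qe; have [|w [_ wu]] := pbu X (p ∘ v) (q ∘ v).
  by rewrite !compmA pbc.
by rewrite -(wu u) // (wu v).
Qed.

Lemma is_pullback_intro A B Y P (f : hom A Y) (g : hom B Y) (p : hom P A)
    (q : hom P B) :
  f ∘ p = g ∘ q ->
  (forall X (u v : hom X P), p ∘ u = p ∘ v -> q ∘ u = q ∘ v -> u = v) ->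
  (forall X (a : hom X A) (b : hom X B), f ∘ a = g ∘ b ->
    exists u : hom X P, p ∘ u = a /\ q ∘ u = b) ->
  is_pullback f g p q.
Proof.
move=> fg ext lift; split=> // X a b /lift [u [pu qu]].
by exists u; split=> // v [pv qv]; apply: ext; rewrite ?pu ?qu.
Qed.

Lemma limit_lift (Q : graph) (D : diagram Q C) X (t : forall v, hom X (dob D v))
    Y (s : forall v, hom Y (dob D v)) :
  is_limit t -> is_cone s -> exists u : hom Y X, forall v, t v ∘ u = s v.
Proof. by move=> [_ tu] /tu [u [? _]]; exists u. Qed.

Lemma limit_ext (Q : graph) (D : diagram Q C) X (t : forall v, hom X (dob D v))
    Y (u w : hom Y X) :
  is_limit t -> (forall v, t v ∘ u = t v ∘ w) -> u = w.
Proof.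
move=> [tc tu] e; have [|z [_ zu]] := tu Y (fun v => t v ∘ w).
  by move=> k; rewrite compmA tc.
by rewrite -(zu u) // (zu w).
Qed.

Lemma is_limit_intro (Q : graph) (D : diagram Q C) X
    (t : forall v, hom X (dob D v)) :
  is_cone t ->
  (forall Y (u w : hom Y X), (forall v, t v ∘ u = t v ∘ w) -> u = w) ->
  (forall Y (s : forall v, hom Y (dob D v)), is_cone s ->
    exists u : hom Y X, forall v, t v ∘ u = s v) ->
  is_limit t.
Proof.
move=> tc ext lift; split=> // Y s /lift [u us].
by exists u; split=> // w ws; apply: ext => v; rewrite us ws.
Qed.

Lemma limit_unique (Q : graph) (D : diagram Q C) X (t : forall v, hom X (dob D v))
    X' (t' : forall v, hom X' (dob D v)) :
  is_limit t -> is_limit t' ->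
  exists2 u : hom X' X, is_iso u & forall v, t v ∘ u = t' v.
Proof.
move=> tL tL'; have [u tu] := limit_lift tL tL'.1.
have [w tw] := limit_lift tL' tL.1; exists u => //; exists w.
split; [apply: (limit_ext tL')|apply: (limit_ext tL)] => v.
  by rewrite compmA tw tu compm_idr.
by rewrite compmA tu tw compm_idr.
Qed.

Lemma limit_iso (Q : graph) (D : diagram Q C) X (t : forall v, hom X (dob D v))
    X' (u : hom X' X) (t' : forall v, hom X' (dob D v)) :
  is_limit t -> is_iso u -> (forall v, t v ∘ u = t' v) -> is_limit t'.
Proof.
move=> tL [w [wu uw]] tu; apply: is_limit_intro => [e|Y a b ab|Y s /(limit_lift tL) [z tz]].
- by rewrite -!tu compmA tL.1.
- rewrite -[a]compm_idl -[b]compm_idl -wu -!compmA; congr (_ ∘ _).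
  by apply: (limit_ext tL) => v; rewrite !compmA tu.
- by exists (w ∘ z) => v; rewrite -tu -compmA (comp_preid _ uw).
Qed.

Lemma coequalizer_epi A B Y (f g : hom A B) (q : hom B Y) X (a b : hom Y X) :
  is_coequalizer f g q -> a ∘ q = b ∘ q -> a = b.
Proof.
move=> [qe qu] ab; have [|u [_ uu]] := qu X (b ∘ q).
  by rewrite -!compmA qe.
by rewrite -(uu a) // (uu b).
Qed.

Lemma coequalizer_desc A B Y (f g : hom A B) (q : hom B Y) X (h : hom B X) :
  is_coequalizer f g q -> h ∘ f = h ∘ g -> exists u, u ∘ q = h.
Proof. by move=> [_ qu] /qu [u [? _]]; exists u. Qed.

Lemma is_coequalizer_intro A B Y (f g : hom A B) (q : hom B Y) :
  q ∘ f = q ∘ g ->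
  (forall X (a b : hom Y X), a ∘ q = b ∘ q -> a = b) ->
  (forall X (h : hom B X), h ∘ f = h ∘ g -> exists u, u ∘ q = h) ->
  is_coequalizer f g q.
Proof.
move=> qe ext desc; split=> // X h /desc [u uq].
by exists u; split=> // v vq; apply: ext; rewrite uq vq.
Qed.

Lemma coequalizer_iso A B Y Y' (f g : hom A B) (q : hom B Y) (u : hom Y Y') :
  is_coequalizer f g q -> is_iso u -> is_coequalizer f g (u ∘ q).
Proof.
move=> qC [v [vu uv]]; apply: is_coequalizer_intro => [|X a b|X h].
- by rewrite -!compmA qC.1.
- move=> ab; rewrite -[a]compm_idr -[b]compm_idr -uv !compmA; congr (_ ∘ _).
  by apply: (coequalizer_epi qC); rewrite -!compmA.
- move=> /(coequalizer_desc qC) [w wq]; exists (w ∘ v).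
  by rewrite -compmA (comp_preid _ vu).
Qed.

Lemma coequalizer_unique A B Y Y' (f g : hom A B) (q : hom B Y)
    (q' : hom B Y') u :
  is_coequalizer f g q -> is_coequalizer f g q' -> u ∘ q = q' -> is_iso u.
Proof.
move=> qC qC' uq; have [v vq] := coequalizer_desc qC' qC.1; exists v.
split; [apply: (coequalizer_epi qC)|apply: (coequalizer_epi qC')].
  by rewrite -compmA uq vq compm_idl.
by rewrite -compmA vq uq compm_idl.
Qed.

Lemma regular_epi_epi B Y (q : hom B Y) X (a b : hom Y X) :
  is_regular_epi q -> a ∘ q = b ∘ q -> a = b.
Proof. by move=> [A [f [g qC]]]; apply: coequalizer_epi qC. Qed.

Lemma regular_epi_desc B Y R (q : hom B Y) (r1 r2 : hom R B) X (h : hom B X) :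
  is_regular_epi q -> is_kernel_pair q r1 r2 -> h ∘ r1 = h ∘ r2 ->
  exists u, u ∘ q = h.
Proof.
move=> [A [f [g qC]]] rK hr; apply: (coequalizer_desc qC).
have [u [<- <-]] := pullback_lift rK qC.1.
by rewrite !compmA hr.
Qed.

Lemma regular_epi_coequalizer B Y R (q : hom B Y) (r1 r2 : hom R B) :
  is_regular_epi q -> is_kernel_pair q r1 r2 -> is_coequalizer r1 r2 q.
Proof.
move=> qR rK; apply: is_coequalizer_intro; first by case: rK.
- by move=> X a b; apply: regular_epi_epi qR.
- by move=> X h; apply: regular_epi_desc rK.
Qed.

Lemma regular_epi_orthogonal A B N Y (q : hom A B) (n : hom N Y) u v :
  is_regular_epi q -> monic n -> v ∘ q = n ∘ u -> exists w, n ∘ w = v.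
Proof.
move=> qR nM e; have [D [f [g qC]]] := qR.
have [|w wq] := coequalizer_desc (h := u) qC.
  by apply: nM; rewrite !compmA -e -!compmA qC.1.
by exists w; apply: (regular_epi_epi qR); rewrite -compmA wq.
Qed.

Lemma coequalizer_kernel_pair A B R (f : hom A B) (r1 r2 : hom R A) Y
    (q : hom A Y) :
  is_kernel_pair f r1 r2 -> is_coequalizer r1 r2 q -> is_kernel_pair q r1 r2.
Proof.
move=> rK qC; have [h hq] := coequalizer_desc qC rK.1.
apply: is_pullback_intro; first by case: qC.
  by move=> X u v; apply: pullback_ext rK.
move=> X a b ab; apply: (pullback_lift rK).
by rewrite -hq -!compmA ab.
Qed.

(** Pullbacks and joint monicity are expressed below by limits of finite diagrams,
    so that a functor that preserves such limits preserves them as well. *)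

Definition cospan_graph :=
  @Graph (option bool) bool Some (fun=> None).

Definition cospan A B Y (f : hom A Y) (g : hom B Y) : diagram cospan_graph C :=
  @Diagram cospan_graph C
    (fun v => match v with None => Y | Some true => A | Some false => B end)
    (fun e : bool => match e with true => f | false => g end).

Definition cospan_cone (D : diagram cospan_graph C) X
    (a : hom X (dob D (Some true))) (b : hom X (dob D (Some false))) :
    forall v, hom X (dob D v) :=
  fun v => match v with
  | None => dmor D true ∘ a | Some true => a | Some false => b end.

Lemma limit_pullback (D : diagram cospan_graph C) X
    (t : forall v, hom X (dob D v)) :
  is_limit t ->
  is_pullback (dmor D true) (dmor D false) (t (Some true)) (t (Some false)).
Proof.
move=> tL; apply: is_pullback_intro => [|Y u v ea eb|Y a b ab].
- by rewrite (tL.1 true) (tL.1 false).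
- apply: (limit_ext tL) => -[[]|] //.
  by rewrite -(tL.1 true) -!compmA; congr (_ ∘ _).
- have [|u us] := limit_lift (s := cospan_cone a b) tL; first by case.
  by exists u; split; [rewrite (us (Some true))|rewrite (us (Some false))].
Qed.

Lemma pullback_limit (D : diagram cospan_graph C) X
    (a : hom X (dob D (Some true))) (b : hom X (dob D (Some false))) :
  is_pullback (dmor D true) (dmor D false) a b -> is_limit (cospan_cone a b).
Proof.
move=> pb; apply: is_limit_intro => [|Y u w e|Y s sc].
- by case=> //=; rewrite pb.1.
- by apply: (pullback_ext pb); [apply: (e (Some true))|apply: (e (Some false))].
- have [|u [ua ub]] := pullback_lift (a := s (Some true)) (b := s (Some false)) pb.
    by rewrite (sc true) (sc false).
  exists u => -[[]|] //=.
  by rewrite -compmA ua; apply: (sc true).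
Qed.

(** Two copies of R, each with its two maps to the same two copies of A: a cone
    amounts to two maps to R that agree after r1 and after r2. *)
Definition double_span_graph :=
  @Graph (bool + bool)%type (bool * bool)%type
    (fun e => inl e.1) (fun e => inr e.2).

Definition double_span A R (r1 r2 : hom R A) : diagram double_span_graph C :=
  @Diagram double_span_graph C (fun v => match v with inl _ => R | inr _ => A end)
    (fun e => if e.2 then r1 else r2).

Definition double_span_cone (D : diagram double_span_graph C) X
    (a : forall i, hom X (dob D (inl i))) : forall v, hom X (dob D v) :=
  fun v => match v with
  | inl i => a i | inr i => dmor D (true, i) ∘ a true end.

Lemma jointly_monic_limit A R (r1 r2 : hom R A) :
  jointly_monic r1 r2 ->
  is_limit (double_span_cone (D := double_span r1 r2) (fun=> idm R)).
Proof.
move=> rM; apply: is_limit_intro => [[i j]|Y u w e|Y s sc] //=.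
- by move: (e (inl true)); rewrite /= !compm_idl.
- have st : s (inl false) = s (inl true).
    by apply: rM; [move: (sc (true, true)) (sc (false, true))|
      move: (sc (true, false)) (sc (false, false))] => /= -> ->.
  exists (s (inl true)) => -[[]|i] /=; rewrite ?compm_idl ?compm_idr ?st //.
  by rewrite (sc (true, i)).
Qed.

End Basics.

Section FiniteLimits.
Variables (C : category) (fcC : finitely_complete C).
Implicit Types A B X Y Z N P R : C.

Lemma binary_product A B :
  exists P (p : hom P A) (q : hom P B),
    (forall X (u v : hom X P), p ∘ u = p ∘ v -> q ∘ u = q ∘ v -> u = v) /\
    (forall X (a : hom X A) (b : hom X B), exists u, p ∘ u = a /\ q ∘ u = b).
Proof.
pose Q := @Graph bool void (@of_void _) (@of_void _).
pose D := @Diagram Q C (fun v => if v then A else B) (fun e => match e with end).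
have [P [t tL]] := fcC D.
exists P, (t true), (t false); split=> [X u v ea eb|X a b].
  by apply: (limit_ext tL) => -[].
pose s v : hom X (dob D v) := if v as v return hom X (dob D v) then a else b.
have [|u us] := limit_lift (s := s) tL; first by case.
by exists u; split; [apply: (us true)|apply: (us false)].
Qed.

(** This is the pullback of (r1, r2) : R -> A x A along (a, b) : T -> A x A, that
    is, the part of T on which a and b are related. *)
Lemma relation_inverse_image A R T (r1 r2 : hom R A) (a b : hom T A) :
  jointly_monic r1 r2 ->
  exists N (n : hom N T) (k : hom N R),
    [/\ monic n, r1 ∘ k = a ∘ n, r2 ∘ k = b ∘ n
      & forall X (x : hom X T) (y : hom X R),
          r1 ∘ y = a ∘ x -> r2 ∘ y = b ∘ x -> exists z, n ∘ z = x].
Proof.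
move=> rM; have [P [p [q [ext lift]]]] := binary_product A A.
have [r [pr qr]] := lift R r1 r2; have [c [pc qc]] := lift T a b.
have [N [k [n pb]]] := finitely_complete_pullback fcC r c.
exists N, n, k; split.
- move=> X u v e; apply: (pullback_ext pb) => //.
  by apply: rM; rewrite -?pr -?qr -!compmA (comp_pre _ pb.1) e (comp_pre _ pb.1).
- by rewrite -pr -compmA pb.1 compmA pc.
- by rewrite -qr -compmA pb.1 compmA qc.
- move=> X x y e1 e2; have [|z [_ nz]] := pullback_lift (a := y) (b := x) pb.
    by apply: ext; rewrite !compmA ?pr ?qr ?pc ?qc.
  by exists z.
Qed.

Lemma equalizer A B (f g : hom A B) :
  exists N (n : hom N A), [/\ monic n, f ∘ n = g ∘ n
    & forall X (x : hom X A), f ∘ x = g ∘ x -> exists z, n ∘ z = x].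
Proof.
have [|N [n [k [nM e1 e2 nu]]]] :=
    relation_inverse_image (r1 := idm B) (r2 := idm B) f g.
  by move=> X u v; rewrite !compm_idl.
exists N, n; split=> //; first by rewrite -e1 -e2.
by move=> X x e; apply: (nu X x (f ∘ x)); rewrite compm_idl.
Qed.

End FiniteLimits.

(** * Images in exact categories *)

Section Exact.
Variables (C : category) (exC : exact C).
Implicit Types A B X Y Z N P R : C.

Let fcC : finitely_complete C. Proof. by case: exC. Qed.

(** The second factor is a monomorphism since two maps a, b to the coequalizer I
    with the same image in B lift, along a regular epimorphism onto their domain,
    to a pair of maps to A that lies in the kernel pair of f. *)
Lemma image_factorization A B (f : hom A B) :
  exists I (q : hom A I) (n : hom I B), [/\ is_regular_epi q, monic n & f = n ∘ q].
Proof.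
have [_ cok stab _] := exC.
have [R [r1 [r2 rK]]] := finitely_complete_pullback fcC f f.
have [I [q qC]] := cok _ _ _ _ _ _ rK.
have qR : is_regular_epi q by exists R, r1, r2.
have [n nq] := coequalizer_desc qC rK.1.
exists I, q, n; split=> // X a b nab.
have [X1 [a' [x1 pb1]]] := finitely_complete_pullback fcC q a.
have [X2 [b' [x2 pb2]]] := finitely_complete_pullback fcC q (b ∘ x1).
have x1R := stab _ _ _ _ _ _ _ _ pb1 qR.
have x2R := stab _ _ _ _ _ _ _ _ pb2 qR.
apply: (regular_epi_epi x1R); apply: (regular_epi_epi x2R).
rewrite -pb2.1 -compmA -(comp_pre _ pb1.1).
have [|u [<- <-]] := pullback_lift (a := a' ∘ x2) (b := b') rK; last first.
  by rewrite compmA qC.1 compmA.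
by rewrite -nq -!compmA pb2.1 (comp_pre _ pb1.1) -compmA (comp_pre _ nab).
Qed.

Lemma strong_epi_regular A B (f : hom A B) :
  (forall N (n : hom N B) u, monic n -> f = n ∘ u -> is_iso n) ->
  is_regular_epi f.
Proof.
move=> fS; have [I [q [n [[R [r1 [r2 qC]]] nM e]]]] := image_factorization f.
exists R, r1, r2; rewrite e; apply: coequalizer_iso qC _.
exact: fS nM e.
Qed.

End Exact.

(** * Pullbacks of split epimorphisms in protomodular categories *)

(** A pullback of two split epimorphisms, with the two maps into it that the
    splittings induce: on elements, first x = (x, t (f x)) and
    second y = (s (g y), y). *)
Record is_split_pullback (C : category) (A B Y P : C) (f : hom A Y) (g : hom B Y)
    (s : hom Y A) (t : hom Y B) (p : hom P A) (q : hom P B) (l : hom A P)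
    (r : hom B P) : Prop := SplitPullback {
  split_pb : is_pullback f g p q;
  split_fs : f ∘ s = idm Y;
  split_gt : g ∘ t = idm Y;
  split_pl : p ∘ l = idm A;
  split_ql : q ∘ l = t ∘ f;
  split_pr : p ∘ r = s ∘ g;
  split_qr : q ∘ r = idm B
}.

Lemma split_pullback_sections (C : category) (A B Y P : C) (f : hom A Y)
    (g : hom B Y) (s : hom Y A) (t : hom Y B) (p : hom P A) (q : hom P B) :
  is_pullback f g p q -> f ∘ s = idm Y -> g ∘ t = idm Y ->
  exists l r, is_split_pullback f g s t p q l r.
Proof.
move=> pb fs gt.
have [|l [pl ql]] := pullback_lift (a := idm A) (b := t ∘ f) pb.
  by rewrite compm_idr compmA gt compm_idl.
have [|r [pr qr]] := pullback_lift (a := s ∘ g) (b := idm B) pb.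
  by rewrite compm_idr compmA fs compm_idl.
by exists l, r; split.
Qed.

Section SplitPullbackMaps.
Variables (C : category) (A B Y P A' B' Y' P' : C).
Variables (f : hom A Y) (g : hom B Y) (s : hom Y A) (t : hom Y B).
Variables (p : hom P A) (q : hom P B) (l : hom A P) (r : hom B P).
Variables (f' : hom A' Y') (g' : hom B' Y') (s' : hom Y' A') (t' : hom Y' B').
Variables (p' : hom P' A') (q' : hom P' B') (l' : hom A' P') (r' : hom B' P').
Variables (a : hom A A') (b : hom B B') (y : hom Y Y') (u : hom P P').
Hypothesis sp : is_split_pullback f g s t p q l r.
Hypothesis sp' : is_split_pullback f' g' s' t' p' q' l' r'.
Hypotheses (pu : p' ∘ u = a ∘ p) (qu : q' ∘ u = b ∘ q).

Lemma split_pullback_map_left :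
  f' ∘ a = y ∘ f -> b ∘ t = t' ∘ y -> u ∘ l = l' ∘ a.
Proof.
move=> fa bt; apply: (pullback_ext (split_pb sp')); rewrite compmA ?pu ?qu -compmA.
  by rewrite (split_pl sp) compm_idr (comp_preid _ (split_pl sp')).
by rewrite (split_ql sp) (comp_pre _ (split_ql sp')) fa (comp_pre _ bt).
Qed.

Lemma split_pullback_map_right :
  g' ∘ b = y ∘ g -> a ∘ s = s' ∘ y -> u ∘ r = r' ∘ b.
Proof.
move=> gb as'; apply: (pullback_ext (split_pb sp')); rewrite compmA ?pu ?qu -compmA.
  by rewrite (split_pr sp) (comp_pre _ (split_pr sp')) gb (comp_pre _ as').
by rewrite (split_qr sp) compm_idr (comp_preid _ (split_qr sp')).
Qed.

End SplitPullbackMaps.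

Section SplitPullbacks.
Variables (C : category) (fcC : finitely_complete C) (pmC : protomodular C).
Variables (A B Y P : C) (f : hom A Y) (g : hom B Y) (s : hom Y A) (t : hom Y B).
Variables (p : hom P A) (q : hom P B) (l : hom A P) (r : hom B P).
Hypothesis sp : is_split_pullback f g s t p q l r.

(** A subobject N of P through which r factors is a morphism of points over B;
    changing base along t turns it into the subobject of A of those x with l x
    in N, which is all of A when l factors through N as well. *)
Lemma split_pullback_strong N (n : hom N P) l' r' :
  monic n -> n ∘ l' = l -> n ∘ r' = r -> is_iso n.
Proof.
move=> nM nl nr.
apply: (pmC (p := q ∘ n) (s := r') (p' := q) (s' := r) (v := t)
            (q := l') (p0 := f) (q' := l) (p0' := f) (b0 := idm A)).
- by split; rewrite -?compmA ?nr ?(split_qr sp).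
- apply: is_pullback_intro => [|X u v e _|X a b ab].
  + by rewrite -compmA nl (split_ql sp).
  + have := congr1 (fun z => p ∘ (n ∘ z)) e.
    by rewrite /= !(comp_pre1 _ nl) !(comp_preid _ (split_pl sp)).
  + have e : n ∘ (l' ∘ (p ∘ (n ∘ a))) = n ∘ a.
      rewrite (comp_pre1 _ nl); apply: (pullback_ext (split_pb sp)).
        by rewrite (comp_preid _ (split_pl sp)).
      rewrite (comp_pre _ (split_ql sp)) (comp_pre _ (split_pb sp).1).
      rewrite [q ∘ _]compmA ab.
      by rewrite (comp_preid _ (split_gt sp)).
    exists (p ∘ (n ∘ a)); split; first exact: nM.
    rewrite (comp_pre _ (split_pb sp).1) [q ∘ _]compmA ab.
    by rewrite (comp_preid _ (split_gt sp)).
- apply: is_pullback_intro => [|X u v e _|X a b ab].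
  + by rewrite (split_ql sp).
  + have := congr1 (fun z => p ∘ z) e.
    by rewrite /= !(comp_preid _ (split_pl sp)).
  + have fb : f ∘ (p ∘ a) = b.
      by rewrite (comp_pre _ (split_pb sp).1) ab (comp_preid _ (split_gt sp)).
    exists (p ∘ a); split=> //; apply: (pullback_ext (split_pb sp)).
      by rewrite (comp_preid _ (split_pl sp)).
    by rewrite (comp_pre _ (split_ql sp)) fb.
- by rewrite nl compm_idr.
- by rewrite compm_idr.
- exact: is_iso_id.
Qed.

Lemma split_pullback_epi X (u v : hom P X) :
  u ∘ l = v ∘ l -> u ∘ r = v ∘ r -> u = v.
Proof.
move=> /= el er; have [N [n [nM e nu]]] := equalizer fcC u v.
have [l' nl] := nu _ _ el; have [r' nr] := nu _ _ er.
have [n' [_ nn']] := split_pullback_strong nM nl nr.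
by rewrite -[u]compm_idr -[v]compm_idr -nn' !compmA e.
Qed.

Lemma split_pullback_cover S (i : hom A S) (j : hom B S) w :
  exact C -> w ∘ i = l -> w ∘ j = r -> is_regular_epi w.
Proof.
move=> exC wi wj; apply: strong_epi_regular => // N n u nM e.
by apply: (split_pullback_strong (l' := u ∘ i) (r' := u ∘ j) nM);
  rewrite compmA -e.
Qed.

End SplitPullbacks.

(** * The Mal'tsev property and coequalizers *)

Section Maltsev.
Variables (C : category) (fcC : finitely_complete C) (pmC : protomodular C).
Variables (A R : C) (r1 r2 : hom R A).
Hypothesis rM : jointly_monic r1 r2.

(** The zigzags x R y, z R y, z R w form a pullback of the split epimorphisms
    from the kernel pairs of r2 and of r1 to R. The zigzags with x R w form a
    subobject, and it contains those whose first two edges coincide and those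
    whose last two edges coincide; these are the images of the two sections. *)
Lemma difunctional X (a b c : hom X R) :
  r2 ∘ a = r2 ∘ b -> r1 ∘ b = r1 ∘ c ->
  exists d : hom X R, r1 ∘ d = r1 ∘ a /\ r2 ∘ d = r2 ∘ c.
Proof.
move=> ab bc.
have [E2 [a1 [a2 pb2]]] := finitely_complete_pullback fcC r2 r2.
have [E1 [b1 [b2 pb1]]] := finitely_complete_pullback fcC r1 r1.
have [d2 [a1d a2d]] := pullback_lift (a := idm R) (b := idm R) pb2 erefl.
have [d1 [b1d b2d]] := pullback_lift (a := idm R) (b := idm R) pb1 erefl.
have [T [p [q pb]]] := finitely_complete_pullback fcC a2 b1.
have [l [r sp]] := split_pullback_sections pb a2d b1d.
have [N [n [k [nM k1 k2 nu]]]] :=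
  relation_inverse_image fcC (r1 ∘ a1 ∘ p) (r2 ∘ b2 ∘ q) rM.
have [||l' nl] := nu _ l a1.
- by rewrite -compmA (split_pl sp) compm_idr.
- by rewrite -compmA (split_ql sp) -compmA (comp_preid _ b2d) pb2.1.
have [||r' nr] := nu _ r b2.
- by rewrite -compmA (split_pr sp) -compmA (comp_preid _ a1d) pb1.1.
- by rewrite -compmA (split_qr sp) compm_idr.
have [n' [_ nn']] := split_pullback_strong pmC sp nM nl nr.
have [x [x1 x2]] := pullback_lift pb2 ab; have [y [y1 y2]] := pullback_lift pb1 bc.
have [|z [pz qz]] := pullback_lift (a := x) (b := y) pb; first by rewrite x2 y1.
exists (k ∘ (n' ∘ z)); rewrite (comp_pre _ k1) (comp_pre _ k2).
by rewrite (comp_preid _ nn') -!compmA pz qz x1 y2.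
Qed.

Lemma reflexive_equivalence e :
  r1 ∘ e = idm A -> r2 ∘ e = idm A -> is_equivalence_relation r1 r2.
Proof.
move=> e1 e2; split=> //; first by exists e.
- have [||s [s1 s2]] := difunctional (a := e ∘ r2) (b := idm R) (c := e ∘ r1).
  + by rewrite (comp_preid _ e2) compm_idr.
  + by rewrite (comp_preid _ e1) compm_idr.
  by exists s; rewrite s1 s2 (comp_preid _ e1) (comp_preid _ e2).
- move=> P p q pb.
  apply: (difunctional (b := e ∘ (r2 ∘ p))).
    by rewrite (comp_preid _ e2).
  by rewrite (comp_preid _ e1) pb.1.
Qed.

End Maltsev.

Section Coequalizers.
Variables (C : category) (exC : exact C) (pmC : protomodular C).

Let fcC : finitely_complete C. Proof. by case: exC. Qed.

(** The image of (f, g) is a reflexive relation, hence an equivalence relation,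
    hence the kernel pair of a morphism, which has a coequalizer. *)
Lemma reflexive_coequalizer (X Y : C) (f g : hom X Y) s :
  f ∘ s = idm Y -> g ∘ s = idm Y -> exists Z (q : hom Y Z), is_coequalizer f g q.
Proof.
move=> fs gs; have [P [p [q [ext lift]]]] := binary_product fcC Y Y.
have [fg [pf qg]] := lift X f g.
have [I [h [n [hR nM e]]]] := image_factorization exC fg.
have rM : jointly_monic (p ∘ n) (q ∘ n).
  by move=> Z u v e1 e2; apply: nM; apply: ext; rewrite !compmA.
have p' : p ∘ n ∘ h = f by rewrite -compmA -e.
have q' : q ∘ n ∘ h = g by rewrite -compmA -e.
have rE : is_equivalence_relation (p ∘ n) (q ∘ n).
  by apply: (reflexive_equivalence fcC pmC rM (e := h ∘ s));
    rewrite compmA ?p' ?q'.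
have [_ cok _ eff] := exC.
have [B [k kK]] := eff _ _ _ _ rE.
have [Z [c cC]] := cok _ _ _ _ _ _ kK.
exists Z, c; apply: is_coequalizer_intro => [|W a b|W a].
- by rewrite -p' -q' !compmA -[c ∘ p ∘ n]compmA cC.1 !compmA.
- exact: (coequalizer_epi cC).
- move=> ae; apply: (coequalizer_desc cC); apply: (regular_epi_epi hR).
  by rewrite -!compmA [p ∘ (n ∘ h)]compmA [q ∘ (n ∘ h)]compmA p' q'.
Qed.

Lemma coequalizers (X Y : C) (f g : hom X Y) :
  has_binary_coproducts C -> exists Z (q : hom Y Z), is_coequalizer f g q.
Proof.
move=> cpC; have [S [i [j cp]]] := cpC X Y.
have [f' [[fi fj] _]] := cp Y f (idm Y); have [g' [[gi gj] _]] := cp Y g (idm Y).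
have [Z [q qC]] := reflexive_coequalizer fj gj.
exists Z, q; apply: is_coequalizer_intro => [|W a b|W a e].
- by rewrite -fi -gi !compmA qC.1.
- exact: (coequalizer_epi qC).
- apply: (coequalizer_desc qC).
  have [w [_ wu]] := cp W (a ∘ f) a.
  rewrite -(wu (a ∘ f')) ?(wu (a ∘ g')) //; split; rewrite -compmA.
  + by rewrite gi e.
  + by rewrite gj compm_idr.
  + by rewrite fi.
  + by rewrite fj compm_idr.
Qed.

End Coequalizers.

(** * Reflexive graphs with a unital multiplication *)

Record rgraph (C : category) := RGraph {
  robj : C;
  rarr : C;
  rdom : hom rarr robj;
  rcod : hom rarr robj;
  rid : hom robj rarr;
  rdom_id : rdom ∘ rid = idm robj;
  rcod_id : rcod ∘ rid = idm robj
}.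

Definition is_graph_map (C : category) (X Y : rgraph C)
    (f0 : hom (robj X) (robj Y)) (f1 : hom (rarr X) (rarr Y)) :=
  [/\ rdom Y ∘ f1 = f0 ∘ rdom X, rcod Y ∘ f1 = f0 ∘ rcod X
    & f1 ∘ rid X = rid Y ∘ f0].

(** A composition of arrows that is only asked to have the identities as units;
    no compatibility with domains and codomains is required. *)
Record multiplication (C : category) (X : rgraph C) := Multiplication {
  mpairs : C;
  mfst : hom mpairs (rarr X);
  msnd : hom mpairs (rarr X);
  mleft : hom (rarr X) mpairs;
  mright : hom (rarr X) mpairs;
  mmul : hom mpairs (rarr X);
  msplit : is_split_pullback (rcod X) (rdom X) (rid X) (rid X) mfst msnd
             mleft mright;
  mmul_left : mmul ∘ mleft = idm (rarr X);
  mmul_right : mmul ∘ mright = idm (rarr X)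
}.

Section Composition.
Variables (C : category) (C1 C2 : C) (p1 p2 m : hom C2 C1).

Lemma composes_comp X (f g h : hom X C1) Y (y : hom Y X) :
  composes p1 p2 m f g h -> composes p1 p2 m (f ∘ y) (g ∘ y) (h ∘ y).
Proof. by move=> [u [<- <- <-]]; exists (u ∘ y); rewrite !compmA. Qed.

Lemma composes_eq C0 (c d : hom C1 C0) X (f g h h' : hom X C1) :
  is_pullback c d p1 p2 ->
  composes p1 p2 m f g h -> composes p1 p2 m f g h' -> h = h'.
Proof.
move=> pb [u [u1 u2 <-]] [v [v1 v2 <-]]; congr (_ ∘ _).
by apply: (pullback_ext pb); rewrite ?u1 ?u2.
Qed.

Lemma composes_ex C0 (c d : hom C1 C0) X (f g : hom X C1) :
  is_pullback c d p1 p2 -> c ∘ f = d ∘ g -> exists h, composes p1 p2 m f g h.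
Proof.
by move=> pb /(pullback_lift pb) [u [u1 u2]]; exists (m ∘ u); exists u.
Qed.

End Composition.

Section Multiplications.
Variables (C : category) (fcC : finitely_complete C) (pmC : protomodular C).
Variables (X : rgraph C) (M : multiplication X).

Let d := rdom X.
Let c := rcod X.
Let e := rid X.
Let p1 := mfst M.
Let p2 := msnd M.
Let l := mleft M.
Let r := mright M.
Let m := mmul M.
Let sp := msplit M.
Let pb := split_pb sp.

Let pl : p1 ∘ l = idm _. Proof. exact: split_pl sp. Qed.
Let ql : p2 ∘ l = e ∘ c. Proof. exact: split_ql sp. Qed.
Let pr : p1 ∘ r = e ∘ d. Proof. exact: split_pr sp. Qed.
Let qr : p2 ∘ r = idm _. Proof. exact: split_qr sp. Qed.
Let cp : c ∘ p1 = d ∘ p2. Proof. exact: pb.1. Qed.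
Let de : d ∘ e = idm _. Proof. exact: rdom_id. Qed.
Let ce : c ∘ e = idm _. Proof. exact: rcod_id. Qed.
Let ml : m ∘ l = idm _. Proof. exact: mmul_left. Qed.
Let mr : m ∘ r = idm _. Proof. exact: mmul_right. Qed.

Lemma dom_mul : d ∘ m = d ∘ p1.
Proof.
apply: (split_pullback_epi fcC pmC sp); rewrite -!compmA -/l -/r ?ml ?mr ?pl ?pr //.
by rewrite (comp_preid _ de) compm_idr.
Qed.

Lemma cod_mul : c ∘ m = c ∘ p2.
Proof.
apply: (split_pullback_epi fcC pmC sp); rewrite -!compmA -/l -/r ?ml ?mr ?ql ?qr //.
by rewrite (comp_preid _ ce) compm_idr.
Qed.

Lemma mul_idl : composes p1 p2 m (e ∘ d) (idm _) (idm _).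
Proof. by exists r. Qed.

Lemma mul_idr : composes p1 p2 m (idm _) (e ∘ c) (idm _).
Proof. by exists l. Qed.

(** Composable triples form a pullback of p2 and p1, which are split by r and l;
    by the joint epimorphy of the two maps into that pullback it is enough to
    compare the two bracketings of x y 1 and of 1 x y. *)
Lemma mul_assoc Y (f g h fg gh k : hom Y (rarr X)) :
  composes p1 p2 m f g fg -> composes p1 p2 m g h gh ->
  composes p1 p2 m fg h k -> composes p1 p2 m f gh k.
Proof.
move=> [u [u1 u2 u3]] [v [v1 v2 v3]] [w [w1 w2 w3]].
have [T [t1 [t2 pbT]]] := finitely_complete_pullback fcC p2 p1.
have [L [R spT]] := split_pullback_sections pbT qr pl.
have [|a [a1 a2]] := pullback_lift (a := m ∘ t1) (b := p2 ∘ t2) pb.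
  by rewrite -/c -/d compmA cod_mul -compmA pbT.1 !compmA cp.
have [|b [b1 b2]] := pullback_lift (a := p1 ∘ t1) (b := m ∘ t2) pb.
  by rewrite -/c -/d [d ∘ _]compmA dom_mul -compmA -pbT.1 !compmA cp.
have ab : m ∘ a = m ∘ b.
  apply: (split_pullback_epi fcC pmC spT); rewrite -!compmA.
  - have -> : a ∘ L = l ∘ m.
      apply: (pullback_ext pb).
        by rewrite compmA a1 -compmA (split_pl spT) compm_idr (comp_preid _ pl).
      rewrite compmA a2 -compmA (split_ql spT) (comp_pre _ ql) (comp_pre _ ql).
      by rewrite cod_mul.
    have -> : b ∘ L = idm _.
      apply: (pullback_ext pb).
        by rewrite compmA b1 -compmA (split_pl spT).
      by rewrite compmA b2 -compmA (split_ql spT) (comp_preid _ ml) compm_idr.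
    by rewrite (comp_preid _ ml) compm_idr.
  - have -> : a ∘ R = idm _.
      apply: (pullback_ext pb).
        by rewrite compmA a1 -compmA (split_pr spT) (comp_preid _ mr) compm_idr.
      by rewrite compmA a2 -compmA (split_qr spT).
    have -> : b ∘ R = r ∘ m.
      apply: (pullback_ext pb); last first.
        by rewrite compmA b2 -compmA (split_qr spT) compm_idr (comp_preid _ qr).
      rewrite compmA b1 -compmA (split_pr spT) (comp_pre _ pr) (comp_pre _ pr).
      by rewrite dom_mul.
    by rewrite (comp_preid _ mr) compm_idr.
have [|x [x1 x2]] := pullback_lift (a := u) (b := v) pbT; first by rewrite u2.
exists (b ∘ x); split.
- by rewrite compmA b1 -compmA x1.
- by rewrite compmA b2 -compmA x2.
rewrite compmA -ab -compmA -w3; congr (_ ∘ _); apply: (pullback_ext pb).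
  by rewrite compmA a1 -compmA x1 u3.
by rewrite compmA a2 -compmA x2 v2.
Qed.

(** The map (f, g) |-> (f, f g) to the pairs of arrows with a common domain is a
    morphism of points over the first component, and over the identities it is
    the identity of g; protomodularity makes it invertible. *)
Lemma mul_shear_inverse :
  exists Q (q1 q2 : hom Q (rarr X)) (s : hom Q (mpairs M)),
    [/\ is_pullback d d q1 q2, p1 ∘ s = q1 & m ∘ s = q2].
Proof.
have [Q [q1 [q2 pbQ]]] := finitely_complete_pullback fcC d d.
have [|phi [f1 f2]] := pullback_lift (a := p1) (b := m) pbQ.
  by rewrite dom_mul.
have [diag [g1 g2]] := pullback_lift (a := idm _) (b := idm _) pbQ erefl.
have [|rho [h1 h2]] := pullback_lift (a := e ∘ d) (b := idm _) pbQ.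
  by rewrite (comp_preid _ de) compm_idr.
suff [s [_ sK]] : is_iso phi.
  exists Q, q1, q2, s; split=> //.
    by rewrite -f1 -compmA sK compm_idr.
  by rewrite -f2 -compmA sK compm_idr.
apply: (pmC (p := p1) (s := l) (p' := q1) (s' := diag) (v := e)
            (q := r) (p0 := d) (q' := rho) (p0' := d) (b0 := idm _)).
- split=> //; apply: (pullback_ext pbQ).
    by rewrite compmA f1 pl.
  by rewrite compmA f2 ml.
- apply: is_pullback_intro => [|Y u v ruv _|Y a b ab].
  + by rewrite pr.
  + by rewrite -[u](comp_preid _ qr) ruv (comp_preid _ qr).
  + have db : d ∘ (p2 ∘ a) = b.
      by rewrite -(comp_pre _ cp) ab (comp_preid _ ce).
    exists (p2 ∘ a); split=> //; apply: (pullback_ext pb).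
      by rewrite -/p1 (comp_pre _ pr) db ab.
    by rewrite -/p2 (comp_preid _ qr).
- apply: is_pullback_intro => [|Y u v ruv _|Y a b ab].
  + by rewrite h1.
  + by rewrite -[u](comp_preid _ h2) ruv (comp_preid _ h2).
  + have db : d ∘ (q2 ∘ a) = b.
      by rewrite -(comp_pre _ pbQ.1) ab (comp_preid _ de).
    exists (q2 ∘ a); split=> //; apply: (pullback_ext pbQ).
      by rewrite (comp_pre _ h1) db ab.
    by rewrite (comp_preid _ h2).
- rewrite compm_idr; apply: (pullback_ext pbQ).
    by rewrite h1 compmA f1 pr.
  by rewrite h2 compmA f2 mr.
- by rewrite compm_idr.
- exact: is_iso_id.
Qed.

Lemma mul_inverse : exists i : hom (rarr X) (rarr X),
  [/\ d ∘ i = c, c ∘ i = d, composes p1 p2 m (idm _) i (e ∘ d)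
    & composes p1 p2 m i (idm _) (e ∘ c)].
Proof.
have [Q [q1 [q2 [s [pbQ s1 s2]]]]] := mul_shear_inverse.
have [|x [x1 x2]] := pullback_lift (a := idm _) (b := e ∘ d) pbQ.
  by rewrite (comp_preid _ de) compm_idr.
pose i := p2 ∘ (s ∘ x).
have di : d ∘ i = c by rewrite -(comp_pre _ cp) (comp_pre1 _ s1) x1 compm_idr.
have ci : c ∘ i = d.
  by rewrite /i -(comp_pre _ cod_mul) (comp_pre1 _ s2) x2 (comp_preid _ ce).
have ri : composes p1 p2 m (idm _) i (e ∘ d).
  by exists (s ∘ x); rewrite (comp_pre1 _ s1) x1 (comp_pre1 _ s2) x2.
exists i; split=> //.
(* A right inverse for every arrow is a left inverse, as in a monoid. *)
have rii : composes p1 p2 m i (i ∘ i) (e ∘ c).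
  by move: (composes_comp i ri); rewrite compm_idl -compmA di.
have [|y iy] := composes_ex (f := i) (g := idm _) m pb.
  by rewrite -/c -/d ci compm_idr.
have cy : c ∘ y = c.
  by have [z [_ z2 <-]] := iy; rewrite (comp_pre _ cod_mul) z2 compm_idr.
have [|k yk] := composes_ex (f := y) (g := i) m pb.
  by rewrite -/c -/d cy di.
have ik : k = i.
  apply: (composes_eq pb (mul_assoc iy ri yk)).
  by move: (composes_comp i mul_idr); rewrite -compmA ci compm_idl.
rewrite ik in yk.
suff -> : e ∘ c = y by [].
apply: (composes_eq pb (mul_assoc yk rii rii)).
by move: (composes_comp y mul_idr); rewrite -compmA cy compm_idl.
Qed.

(* The inverse is a choice of a witness, taken inside the record so that the other
   components of the groupoid compute. *)
Definition groupoid_of_multiplication : groupoid C.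
Proof.
exists (robj X) (rarr X) (mpairs M) d c e p1 p2 m (sval (cid mul_inverse)) => //;
  try by case: cid => i [].
- exact: dom_mul.
- exact: cod_mul.
- exact: mul_idl.
- exact: mul_idr.
- exact: mul_assoc.
Defined.

End Multiplications.

Definition graph_of (C : category) (G : groupoid C) : rgraph C :=
  RGraph (gdom_id G) (gcod_id G).

Lemma groupoid_sections (C : category) (G : groupoid C) :
  exists l r, [/\ is_split_pullback (gcod G) (gdom G) (gid G) (gid G) (gfst G)
                    (gsnd G) l r, gmul G ∘ l = idm _ & gmul G ∘ r = idm _].
Proof.
have [r [r1 r2 r3]] := gmul_idl G; have [l [l1 l2 l3]] := gmul_idr G.
exists l, r; split=> //.
by split; rewrite ?gdom_id ?gcod_id //; apply: gpairs_pullback.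
Qed.

(** * Maps of reflexive graphs between groupoids *)

Section Functors.
Variables (C : category) (fcC : finitely_complete C) (pmC : protomodular C).
Variables (G H : groupoid C).

(** The two ways to send a composable pair of G to an arrow of H agree on the pairs
    (f, 1) and (1, g), where the unit laws compute them. *)
Lemma graph_map_mul (f0 : hom (gob G) (gob H)) (f1 : hom (garr G) (garr H)) :
  is_graph_map (X := graph_of G) (Y := graph_of H) f0 f1 ->
  composes (gfst H) (gsnd H) (gmul H) (f1 ∘ gfst G) (f1 ∘ gsnd G) (f1 ∘ gmul G).
Proof.
move=> [/= fd fc fe].
have [l [r [sp ml mr]]] := groupoid_sections G.
have [l' [r' [sp' ml' mr']]] := groupoid_sections H.
have [|u [u1 u2]] :=
    pullback_lift (a := f1 ∘ gfst G) (b := f1 ∘ gsnd G) (gpairs_pullback H).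
  by rewrite !compmA fc fd -!compmA (gpairs_pullback G).1.
exists u; split=> //; apply: (split_pullback_epi fcC pmC sp); rewrite -!compmA.
- rewrite (split_pullback_map_left sp sp' u1 u2 fc fe).
  by rewrite (comp_preid _ ml') ml compm_idr.
- rewrite (split_pullback_map_right sp sp' u1 u2 fd fe).
  by rewrite (comp_preid _ mr') mr compm_idr.
Qed.

Definition functor_of_graph_map f0 f1
    (f : is_graph_map (X := graph_of G) (Y := graph_of H) f0 f1) :
  internal_functor G H.
Proof. by exists f0 f1; first [exact: (graph_map_mul f)|case: f]. Defined.

End Functors.

(** A quotient of a reflexive graph inherits a unital multiplication as soon as a
    multiplication with values in the quotient is defined on the original pairs.

    The pairs of the quotient Y are covered by the pairs of X: the image of the
    comparison contains the images of the two sections, because those are covered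
    by f1. Two composable pairs identified in Y amount to a composable pair of the
    kernel pair of the graph map, which is itself a reflexive graph; there the
    multiplication can be compared on the two sections. *)
Lemma quotient_multiplication (C : category) (exC : exact C)
    (pmC : protomodular C) (X Y : rgraph C) (f0 : hom (robj X) (robj Y))
    (f1 : hom (rarr X) (rarr Y)) P (p1 p2 : hom P (rarr X)) l r
    (m : hom P (rarr Y)) :
  is_graph_map f0 f1 -> is_regular_epi f1 ->
  is_split_pullback (rcod X) (rdom X) (rid X) (rid X) p1 p2 l r ->
  m ∘ l = f1 -> m ∘ r = f1 -> inhabited (multiplication Y).
Proof.
move=> [fd fc fe] fR sp ml mr; have [fcC _ _ _] := exC.
have [P' [q1 [q2 pb']]] := finitely_complete_pullback fcC (rcod Y) (rdom Y).
have [l' [r' sp']] := split_pullback_sections pb' (rcod_id Y) (rdom_id Y).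
have [|h [h1 h2]] := pullback_lift (a := f1 ∘ p1) (b := f1 ∘ p2) pb'.
  by rewrite !compmA fc fd -!compmA (split_pb sp).1.
have hl := split_pullback_map_left sp sp' h1 h2 fc fe.
have hr := split_pullback_map_right sp sp' h1 h2 fd fe.
have hR : is_regular_epi h.
  apply: strong_epi_regular => // N n u nM e.
  have [|l1 nl1] := regular_epi_orthogonal (u := u ∘ l) (v := l') fR nM.
    by rewrite compmA -e hl.
  have [|r1 nr1] := regular_epi_orthogonal (u := u ∘ r) (v := r') fR nM.
    by rewrite compmA -e hr.
  exact: (split_pullback_strong pmC sp' nM nl1 nr1).
have [E [e1 [e2 pbE]]] := finitely_complete_pullback fcC h h.
suff me : m ∘ e1 = m ∘ e2.
  have [m' mh] := regular_epi_desc hR pbE me.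
  have ml' : m' ∘ l' = idm _.
    by apply: (regular_epi_epi fR); rewrite -compmA -hl compmA mh ml compm_idl.
  have mr' : m' ∘ r' = idm _.
    by apply: (regular_epi_epi fR); rewrite -compmA -hr compmA mh mr compm_idl.
  by exists; apply: Multiplication sp' ml' mr'.
have [R0 [a0 [b0 pb0]]] := finitely_complete_pullback fcC f0 f0.
have [R1 [a1 [b1 pb1]]] := finitely_complete_pullback fcC f1 f1.
have [|d [ad bd]] := pullback_lift (a := rdom X ∘ a1) (b := rdom X ∘ b1) pb0.
  by rewrite !compmA -fd -!compmA pb1.1.
have [|c [ac bc]] := pullback_lift (a := rcod X ∘ a1) (b := rcod X ∘ b1) pb0.
  by rewrite !compmA -fc -!compmA pb1.1.
have [|e [ae be]] := pullback_lift (a := rid X ∘ a0) (b := rid X ∘ b0) pb1.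
  by rewrite !compmA fe -!compmA pb0.1.
have de : d ∘ e = idm _.
  apply: (pullback_ext pb0); rewrite compmA ?ad ?bd -compmA ?ae ?be;
    by rewrite (comp_preid _ (rdom_id X)) compm_idr.
have ce : c ∘ e = idm _.
  apply: (pullback_ext pb0); rewrite compmA ?ac ?bc -compmA ?ae ?be;
    by rewrite (comp_preid _ (rcod_id X)) compm_idr.
have [T [t1 [t2 pbT]]] := finitely_complete_pullback fcC c d.
have [L [R spT]] := split_pullback_sections pbT ce de.
have pbX := split_pb sp.
have [|u [u1 u2]] := pullback_lift (a := a1 ∘ t1) (b := a1 ∘ t2) pbX.
  by rewrite !compmA -ac -ad -!compmA pbT.1.
have [|v [v1 v2]] := pullback_lift (a := b1 ∘ t1) (b := b1 ∘ t2) pbX.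
  by rewrite !compmA -bc -bd -!compmA pbT.1.
have uv : m ∘ u = m ∘ v.
  apply: (split_pullback_epi fcC pmC spT); rewrite -!compmA.
  - rewrite (split_pullback_map_left spT sp u1 u2 (esym ac) ae).
    rewrite (split_pullback_map_left spT sp v1 v2 (esym bc) be).
    by rewrite !(comp_pre1 _ ml) pb1.1.
  - rewrite (split_pullback_map_right spT sp u1 u2 (esym ad) ae).
    rewrite (split_pullback_map_right spT sp v1 v2 (esym bd) be).
    by rewrite !(comp_pre1 _ mr) pb1.1.
have [|x [x1 x2]] := pullback_lift (a := p1 ∘ e1) (b := p1 ∘ e2) pb1.
  by rewrite !compmA -h1 -!compmA pbE.1.
have [|y [y1 y2]] := pullback_lift (a := p2 ∘ e1) (b := p2 ∘ e2) pb1.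
  by rewrite !compmA -h2 -!compmA pbE.1.
have [|z [z1 z2]] := pullback_lift (a := x) (b := y) pbT.
  apply: (pullback_ext pb0).
    by rewrite (comp_pre _ ac) (comp_pre _ ad) x1 y1 (comp_pre _ pbX.1).
  by rewrite (comp_pre _ bc) (comp_pre _ bd) x2 y2 (comp_pre _ pbX.1).
have <- : u ∘ z = e1.
  by apply: (pullback_ext pbX); rewrite compmA ?u1 ?u2 -compmA ?z1 ?z2.
have <- : v ∘ z = e2.
  by apply: (pullback_ext pbX); rewrite compmA ?v1 ?v2 -compmA ?z1 ?z2.
by rewrite !compmA uv.
Qed.

(** * Transfer of semi-abelianness along limit-preserving functors *)

Record functor (S C : category) := Functor {
  fmap_ob :> S -> C;
  fmap : forall X Y, hom X Y -> hom (fmap_ob X) (fmap_ob Y);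
  fmap_id : forall X, fmap (idm X) = idm (fmap_ob X);
  fmap_comp : forall X Y Z (g : hom Y Z) (f : hom X Y),
    fmap (g ∘ f) = fmap g ∘ fmap f
}.

Definition map_diagram (S C : category) (F : functor S C) (Q : graph)
    (D : diagram Q S) : diagram Q C :=
  @Diagram Q C (fun v => F (dob D v)) (fun e => fmap F (dmor D e)).

Lemma fmap_is_iso (S C : category) (F : functor S C) (X Y : S) (f : hom X Y) :
  is_iso f -> is_iso (fmap F f).
Proof.
move=> [g [gf fg]]; exists (fmap F g).
by rewrite -!fmap_comp gf fg !fmap_id.
Qed.

Section Transfer.
Variables (S C : category) (I : Type) (U : I -> functor S C).

Definition lifts_limits :=
  forall (Q : graph) (D : diagram Q S),
    exists X (t : forall v, hom X (dob D v)), is_limit t /\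
      forall i, is_limit (D := map_diagram (U i) D) (fun v => fmap (U i) (t v)).

Definition jointly_conservative :=
  forall (X Y : S) (f : hom X Y), (forall i, is_iso (fmap (U i) f)) -> is_iso f.

(** Quotients by kernel pairs of C are the only colimits that exactness of S
    requires: they give its regular epimorphisms, and the morphisms of which its
    equivalence relations are kernel pairs. *)
Definition lifts_quotients :=
  forall (A R : S) (r1 r2 : hom R A) (Y : I -> C) (q : forall i, hom (U i A) (Y i)),
    (forall i, is_kernel_pair (q i) (fmap (U i) r1) (fmap (U i) r2)) ->
    (forall i, is_coequalizer (fmap (U i) r1) (fmap (U i) r2) (q i)) ->
    exists B (q' : hom A B), is_coequalizer r1 r2 q' /\
      forall i, is_coequalizer (fmap (U i) r1) (fmap (U i) r2) (fmap (U i) q').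

Hypothesis Ulim : lifts_limits.

Lemma fmap_limit i (Q : graph) (D : diagram Q S) X
    (t : forall v, hom X (dob D v)) :
  is_limit t -> is_limit (D := map_diagram (U i) D) (fun v => fmap (U i) (t v)).
Proof.
move=> tL; have [X' [t' [tL' Ut']]] := Ulim D.
have [u uI ut] := limit_unique tL' tL.
apply: limit_iso (Ut' i) (fmap_is_iso (U i) uI) _ => v.
by rewrite -fmap_comp ut.
Qed.

Lemma fmap_pullback i (A B Y P : S) (f : hom A Y) (g : hom B Y) (p : hom P A)
    (q : hom P B) :
  is_pullback f g p q ->
  is_pullback (fmap (U i) f) (fmap (U i) g) (fmap (U i) p) (fmap (U i) q).
Proof.
move=> pb; have tL := pullback_limit (D := cospan f g) pb.
exact: (limit_pullback (fmap_limit i tL)).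
Qed.

Lemma fmap_jointly_monic i (A R : S) (r1 r2 : hom R A) :
  jointly_monic r1 r2 -> jointly_monic (fmap (U i) r1) (fmap (U i) r2).
Proof.
move=> /jointly_monic_limit /(fmap_limit i) tL X u v e1 e2.
pose D := map_diagram (U i) (double_span r1 r2).
pose s (j : bool) : hom X (dob D (inl j)) := if j then u else v.
have [|w ws] := limit_lift (s := double_span_cone s) tL.
  by move=> [[] []] //=; symmetry.
have := ws (inl true); have := ws (inl false).
by rewrite /= fmap_id !compm_idl => <- <-.
Qed.

Lemma transfer_finitely_complete : finitely_complete S.
Proof. by move=> Q D; have [X [t [tL _]]] := Ulim D; exists X, t. Qed.

Let fcS := transfer_finitely_complete.

Lemma fmap_equivalence_relation i (A R : S) (r1 r2 : hom R A) :
  is_equivalence_relation r1 r2 ->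
  is_equivalence_relation (fmap (U i) r1) (fmap (U i) r2).
Proof.
move=> [rM [e [e1 e2]] [s [s1 s2]] tr]; split.
- exact: fmap_jointly_monic.
- by exists (fmap (U i) e); rewrite -!fmap_comp e1 e2 fmap_id.
- by exists (fmap (U i) s); rewrite -!fmap_comp s1 s2.
- move=> P p q pb; have [P' [p' [q' pb']]] := finitely_complete_pullback fcS r2 r1.
  have [t [t1 t2]] := tr _ _ _ pb'.
  have [u [<- <-]] := pullback_lift (fmap_pullback i pb') pb.1.
  exists (fmap (U i) t ∘ u); rewrite !compmA -!fmap_comp t1 t2.
  by rewrite !fmap_comp.
Qed.

Hypothesis Uiso : jointly_conservative.
Hypothesis Uquot : lifts_quotients.
Hypothesis exC : exact C.

(* Exactness of C gives a coequalizer for each i; choosing one for every i gives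
   the family that is to be lifted. *)
Let kernel_pair_quotient (A R : S) (r1 r2 : hom R A)
    (B : I -> C) (f : forall i, hom (U i A) (B i)) :
  (forall i, is_kernel_pair (f i) (fmap (U i) r1) (fmap (U i) r2)) ->
  exists Y (q : hom A Y), is_coequalizer r1 r2 q /\
    forall i, is_coequalizer (fmap (U i) r1) (fmap (U i) r2) (fmap (U i) q).
Proof.
move=> fK; have [_ cok _ _] := exC.
have {}cok i : exists Yq : {Y : C & hom (U i A) Y},
    is_coequalizer (fmap (U i) r1) (fmap (U i) r2) (tagged Yq).
  by have [Y [q qC]] := cok _ _ _ _ _ _ (fK i); exists (Tagged _ q).
pose Yq i := sval (cid (cok i)).
have YqC i : is_coequalizer (fmap (U i) r1) (fmap (U i) r2) (tagged (Yq i)).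
  by rewrite /Yq; case: cid.
apply: (Uquot _ YqC) => i.
exact: coequalizer_kernel_pair (fK i) (YqC i).
Qed.

(** A regular epimorphism is the coequalizer of its kernel pair, so it agrees up to
    isomorphism with the quotient lifted from C, which every U i preserves. *)
Lemma fmap_regular_epi i (A B : S) (f : hom A B) :
  is_regular_epi f -> is_regular_epi (fmap (U i) f).
Proof.
move=> fR; have [R [r1 [r2 rK]]] := finitely_complete_pullback fcS f f.
have fC := regular_epi_coequalizer fR rK.
have [|Y [q [qC Uq]]] := kernel_pair_quotient (r1 := r1) (r2 := r2)
    (B := fun i => U i B) (f := fun i => fmap (U i) f).
  by move=> j; apply: fmap_pullback.
have [u uq] := coequalizer_desc qC fC.1.
have uI := coequalizer_unique qC fC uq.
exists (U i R), (fmap (U i) r1), (fmap (U i) r2); rewrite -uq fmap_comp.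
exact: coequalizer_iso (Uq i) (fmap_is_iso (U i) uI).
Qed.

Lemma regular_epi_of_fmap (A B : S) (f : hom A B) :
  (forall i, is_regular_epi (fmap (U i) f)) -> is_regular_epi f.
Proof.
move=> fR; have [R [r1 [r2 rK]]] := finitely_complete_pullback fcS f f.
have UrK i := fmap_pullback i rK.
have [Y [q [qC Uq]]] := kernel_pair_quotient UrK.
have [u uq] := coequalizer_desc qC rK.1.
have uI : is_iso u.
  apply: Uiso => i.
  apply: coequalizer_unique (Uq i) (regular_epi_coequalizer (fR i) (UrK i)) _.
  by rewrite -fmap_comp uq.
by exists R, r1, r2; rewrite -uq; apply: coequalizer_iso qC uI.
Qed.

(** An equivalence relation in S becomes a kernel pair in C; its lifted quotient q
    has a kernel pair in S that each U i identifies with the given relation, so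
    that the two agree because the U i are jointly conservative. *)
Lemma transfer_exact : exact S.
Proof.
have [_ _ stab eff] := exC; split.
- exact: fcS.
- move=> A B R f r1 r2 rK.
  have [Y [q [qC _]]] := kernel_pair_quotient (fun i => fmap_pullback i rK).
  by exists Y, q.
- move=> A B Y P f g p q pb fR; apply: regular_epi_of_fmap => i.
  exact: stab (fmap_pullback i pb) (fmap_regular_epi i fR).
- move=> A R r1 r2 rE.
  have {}eff i : exists Bf : {B : C & hom (U i A) B},
      is_kernel_pair (tagged Bf) (fmap (U i) r1) (fmap (U i) r2).
    have [B [f fK]] := eff _ _ _ _ (fmap_equivalence_relation i rE).
    by exists (Tagged _ f).
  pose Bf i := sval (cid (eff i)).
  have BfK i : is_kernel_pair (tagged (Bf i)) (fmap (U i) r1) (fmap (U i) r2).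
    by rewrite /Bf; case: cid.
  have [Y [q [qC Uq]]] := kernel_pair_quotient BfK.
  have [K [k1 [k2 kK]]] := finitely_complete_pullback fcS q q.
  have [u [u1 u2]] := pullback_lift kK qC.1.
  have [v [vu uv]] : is_iso u.
    apply: Uiso => i.
    have rK := coequalizer_kernel_pair (BfK i) (Uq i).
    have kK' := fmap_pullback i kK.
    have [v [v1 v2]] := pullback_lift rK kK'.1.
    exists v; split; [apply: (pullback_ext rK)|apply: (pullback_ext kK')];
      by rewrite compmA compm_idr ?v1 ?v2 -fmap_comp ?u1 ?u2.
  exists Y, q; apply: is_pullback_intro => [|X a b e1 e2|X a b ab].
  + by case: qC.
  + by case: rE => rM _ _ _; apply: rM.
  + have [w [<- <-]] := pullback_lift kK ab.
    by exists (v ∘ w); rewrite -u1 -u2 -!compmA (comp_preid _ uv).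
Qed.

Lemma transfer_protomodular : protomodular C -> protomodular S.
Proof.
move=> pm B B' Y E P P' p s p' s' b v q p0 q' p0' b0 [ps ps' pb bs] pb1 pb2 e1 e2 bI.
apply: Uiso => i.
apply: (pm _ _ _ _ _ _ (fmap (U i) p) (fmap (U i) s) (fmap (U i) p')
  (fmap (U i) s') _ (fmap (U i) v) (fmap (U i) q) (fmap (U i) p0)
  (fmap (U i) q') (fmap (U i) p0') (fmap (U i) b0)).
- by split; rewrite -fmap_comp ?ps ?ps' ?pb ?bs ?fmap_id.
- exact: fmap_pullback.
- exact: fmap_pullback.
- by rewrite -!fmap_comp e1.
- by rewrite -fmap_comp e2.
- exact: fmap_is_iso.
Qed.

End Transfer.

(** * Internal groupoids in a semi-abelian category *)

Lemma coproduct_copair (C : category) (A B S : C) (i : hom A S) (j : hom B S) X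
    (f : hom A X) (g : hom B X) :
  is_coproduct i j -> exists u : hom S X, u ∘ i = f /\ u ∘ j = g.
Proof. by move=> /(_ X f g) [u [? _]]; exists u. Qed.

Lemma coproduct_ext (C : category) (A B S : C) (i : hom A S) (j : hom B S) X
    (u v : hom S X) :
  is_coproduct i j -> u ∘ i = v ∘ i -> u ∘ j = v ∘ j -> u = v.
Proof.
move=> cp ei ej; have [w [_ wu]] := cp X (v ∘ i) (v ∘ j).
by rewrite -(wu u) // (wu v).
Qed.

Definition grpd_ob (C : category) : functor (Grpd C) C :=
  @Functor (Grpd C) C (@gob C) (fun G H F => fob F) (fun=> erefl)
    (fun _ _ _ _ _ => erefl).

Definition grpd_arr (C : category) : functor (Grpd C) C :=
  @Functor (Grpd C) C (@garr C) (fun G H F => farr F) (fun=> erefl)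
    (fun _ _ _ _ _ => erefl).

Definition grpd_underlying (C : category) (b : bool) : functor (Grpd C) C :=
  if b then grpd_ob C else grpd_arr C.

Section Grpd.
Variables (C : category) (exC : exact C) (pmC : protomodular C).

Let fcC : finitely_complete C. Proof. by case: exC. Qed.

(** The limits of the objects and of the arrows form a reflexive graph. The
    compositions of the groupoids in the diagram induce a multiplication on it, and
    a unital multiplication is all that a groupoid requires. *)
Lemma groupoid_lifts_limits : lifts_limits (@grpd_underlying C).
Proof.
move=> Q D.
have [X0 [t0 tL0]] := fcC (map_diagram (grpd_ob C) D).
have [X1 [t1 tL1]] := fcC (map_diagram (grpd_arr C) D).
have [d dE] : exists d : hom X1 X0, forall v, t0 v ∘ d = gdom (dob D v) ∘ t1 v.
  apply: (limit_lift tL0) => k /=.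
  by rewrite compmA -fun_dom -compmA; congr (_ ∘ _); apply: tL1.1.
have [c cE] : exists c : hom X1 X0, forall v, t0 v ∘ c = gcod (dob D v) ∘ t1 v.
  apply: (limit_lift tL0) => k /=.
  by rewrite compmA -fun_cod -compmA; congr (_ ∘ _); apply: tL1.1.
have [e eE] : exists e : hom X0 X1, forall v, t1 v ∘ e = gid (dob D v) ∘ t0 v.
  apply: (limit_lift tL1) => k /=.
  by rewrite compmA fun_id -compmA; congr (_ ∘ _); apply: tL0.1.
have de : d ∘ e = idm _.
  apply: (limit_ext tL0) => v.
  by rewrite compmA dE -compmA eE (comp_preid _ (gdom_id _)) compm_idr.
have ce : c ∘ e = idm _.
  apply: (limit_ext tL0) => v.
  by rewrite compmA cE -compmA eE (comp_preid _ (gcod_id _)) compm_idr.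
have [P [p1 [p2 pb]]] := finitely_complete_pullback fcC c d.
have [l [r sp]] := split_pullback_sections pb ce de.
have uex v : exists u : hom P (gpairs (dob D v)),
    gfst (dob D v) ∘ u = t1 v ∘ p1 /\ gsnd (dob D v) ∘ u = t1 v ∘ p2.
  apply: (pullback_lift (gpairs_pullback (dob D v))).
  by rewrite !compmA -cE -dE -!compmA pb.1.
pose u v := sval (cid (uex v)).
have u1 v : gfst (dob D v) ∘ u v = t1 v ∘ p1 by rewrite /u; case: cid => ? [].
have u2 v : gsnd (dob D v) ∘ u v = t1 v ∘ p2 by rewrite /u; case: cid => ? [].
have [m mE] : exists m : hom P X1, forall v, t1 v ∘ m = gmul (dob D v) ∘ u v.
  apply: (limit_lift tL1) => k /=.
  have [w [w1 w2 w3]] := fun_mul (dmor D k).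
  rewrite compmA -w3 -compmA; congr (_ ∘ _).
  apply: (pullback_ext (gpairs_pullback _)).
    by rewrite compmA w1 u1 -compmA u1 compmA; congr (_ ∘ _); apply: tL1.1.
  by rewrite compmA w2 u2 -compmA u2 compmA; congr (_ ∘ _); apply: tL1.1.
have ml : m ∘ l = idm _.
  apply: (limit_ext tL1) => v.
  have [l' [r' [sp' ml' _]]] := groupoid_sections (dob D v).
  have e1 := split_pullback_map_left sp sp' (u1 v) (u2 v) (esym (cE v)) (eE v).
  by rewrite compmA mE -compmA e1 (comp_preid _ ml') compm_idr.
have mr : m ∘ r = idm _.
  apply: (limit_ext tL1) => v.
  have [l' [r' [sp' _ mr']]] := groupoid_sections (dob D v).
  have e1 := split_pullback_map_right sp sp' (u1 v) (u2 v) (esym (dE v)) (eE v).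
  by rewrite compmA mE -compmA e1 (comp_preid _ mr') compm_idr.
pose M := @Multiplication C (RGraph de ce) _ _ _ _ _ _ sp ml mr.
pose L : Grpd C := groupoid_of_multiplication fcC pmC M.
have tM v : is_graph_map (X := graph_of L) (Y := graph_of (dob D v)) (t0 v) (t1 v).
  by split; rewrite /= ?dE ?cE ?eE.
pose t v : hom L (dob D v) := functor_of_graph_map fcC pmC (tM v).
exists L, t; split; last by case.
apply: is_limit_intro => [k|Y a b ab|Y s sc].
- apply: internal_functor_eq; [exact: tL0.1|exact: tL1.1].
- apply: internal_functor_eq.
    by apply: (limit_ext tL0) => v; apply: (congr1 fob (ab v)).
  by apply: (limit_ext tL1) => v; apply: (congr1 farr (ab v)).
- have [|a0 a0E] := limit_lift (D := map_diagram (grpd_ob C) D)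
      (s := fun v => fob (s v)) tL0.
    by move=> k; apply: (congr1 fob (sc k)).
  have [|a1 a1E] := limit_lift (D := map_diagram (grpd_arr C) D)
      (s := fun v => farr (s v)) tL1.
    by move=> k; apply: (congr1 farr (sc k)).
  have aM : is_graph_map (X := graph_of Y) (Y := graph_of L) a0 a1.
    split=> /=.
    + apply: (limit_ext tL0) => v.
      by rewrite compmA dE -compmA a1E compmA a0E fun_dom.
    + apply: (limit_ext tL0) => v.
      by rewrite compmA cE -compmA a1E compmA a0E fun_cod.
    + apply: (limit_ext tL1) => v.
      by rewrite compmA a1E compmA eE -compmA a0E fun_id.
  exists (functor_of_graph_map fcC pmC aM : hom Y L) => v.
  by apply: internal_functor_eq; [apply: a0E|apply: a1E].
Qed.

Lemma groupoid_jointly_conservative : jointly_conservative (@grpd_underlying C).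
Proof.
move=> G H F FI; have [g0 [gf0 fg0]] := FI true; have [g1 [gf1 fg1]] := FI false.
rewrite /= in g0 gf0 fg0 g1 gf1 fg1.
have gM : is_graph_map (X := graph_of H) (Y := graph_of G) g0 g1.
  split=> /=.
  - rewrite -[LHS]compm_idl -gf0 -compmA; congr (_ ∘ _).
    by rewrite compmA -fun_dom -compmA fg1 compm_idr.
  - rewrite -[LHS]compm_idl -gf0 -compmA; congr (_ ∘ _).
    by rewrite compmA -fun_cod -compmA fg1 compm_idr.
  - rewrite -[RHS]compm_idl -gf1 -compmA; congr (_ ∘ _).
    by rewrite compmA fun_id -compmA fg0 compm_idr.
exists (functor_of_graph_map fcC pmC gM : hom (H : Grpd C) G).
by split; apply: internal_functor_eq.
Qed.

(** The quotients of the objects and of the arrows form a reflexive graph, and the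
    multiplication passes to it by [quotient_multiplication]. *)
Lemma groupoid_lifts_quotients : lifts_quotients (@grpd_underlying C).
Proof.
move=> G R r1 r2 Y q qK qC.
have {}qC0 : is_coequalizer (fob r1) (fob r2) (q true) := qC true.
have {}qC1 : is_coequalizer (farr r1) (farr r2) (q false) := qC false.
set q0 := q true in qC0; set q1 := q false in qC1.
rewrite /= in q0 q1 qC0 qC1.
have qR : is_regular_epi q1 by exists (garr R), (farr r1), (farr r2).
have [|d dE] := coequalizer_desc (h := q0 ∘ gdom G) qC1.
  by rewrite -!compmA !fun_dom !compmA qC0.1.
have [|c cE] := coequalizer_desc (h := q0 ∘ gcod G) qC1.
  by rewrite -!compmA !fun_cod !compmA qC0.1.
have [|e eE] := coequalizer_desc (h := q1 ∘ gid G) qC0.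
  by rewrite -!compmA -!fun_id !compmA qC1.1.
have de : d ∘ e = idm _.
  apply: (coequalizer_epi qC0).
  by rewrite -compmA eE compmA dE -compmA gdom_id compm_idr compm_idl.
have ce : c ∘ e = idm _.
  apply: (coequalizer_epi qC0).
  by rewrite -compmA eE compmA cE -compmA gcod_id compm_idr compm_idl.
have [l [r [sp ml mr]]] := groupoid_sections G.
have qM : is_graph_map (X := graph_of G) (Y := RGraph de ce) q0 q1 by split.
have [||M] := quotient_multiplication exC pmC (Y := RGraph de ce)
    (m := q1 ∘ gmul G) qM qR sp.
- by rewrite -compmA ml compm_idr.
- by rewrite -compmA mr compm_idr.
pose H : Grpd C := groupoid_of_multiplication fcC pmC M.
pose p : hom (G : Grpd C) H := functor_of_graph_map fcC pmC (H := H) qM.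
exists H, p; split; last by case.
apply: is_coequalizer_intro => [|K a b ab|K h hr].
- by apply: internal_functor_eq; [apply: qC0.1|apply: qC1.1].
- apply: internal_functor_eq.
    by apply: (coequalizer_epi qC0); apply: (congr1 fob ab).
  by apply: (coequalizer_epi qC1); apply: (congr1 farr ab).
- have [u0 u0E] := coequalizer_desc qC0 (congr1 fob hr).
  have [u1 u1E] := coequalizer_desc qC1 (congr1 farr hr).
  have uM : is_graph_map (X := graph_of H) (Y := graph_of K) u0 u1.
    split=> /=.
    + apply: (coequalizer_epi qC1).
      by rewrite -!compmA u1E dE compmA u0E fun_dom.
    + apply: (coequalizer_epi qC1).
      by rewrite -!compmA u1E cE compmA u0E fun_cod.
    + apply: (coequalizer_epi qC0).
      by rewrite -!compmA u0E eE compmA u1E fun_id.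
  exists (functor_of_graph_map fcC pmC uM : hom H K).
  by apply: internal_functor_eq.
Qed.

Lemma identity_pullback (X : C) :
  is_pullback (idm X) (idm X) (idm X) (idm X).
Proof.
apply: is_pullback_intro => // [Y u v|Y a b]; first by rewrite !compm_idl.
by rewrite !compm_idl => ->; exists b; rewrite compm_idl.
Qed.

Definition discrete_groupoid (X : C) : groupoid C.
Proof.
exists X X X (idm X) (idm X) (idm X) (idm X) (idm X) (idm X) (idm X);
  rewrite ?compm_idl //; try exact: identity_pullback;
  try by exists (idm X); rewrite compm_idl.
move=> Y f g h fg gh k [u [<- <- <-]] [v [vu _ <-]] [w [wu _ <-]].
by exists u; rewrite vu wu.
Defined.

Lemma discrete_groupoid_map (X : C) (G : groupoid C) (x : hom X (gob G)) :
  exists F : internal_functor (discrete_groupoid X) G,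
    fob F = x /\ farr F = gid G ∘ x.
Proof.
have xM : is_graph_map (X := graph_of (discrete_groupoid X)) (Y := graph_of G)
    x (gid G ∘ x).
  by split; rewrite /= ?(comp_preid _ (gdom_id G)) ?(comp_preid _ (gcod_id G))
    ?compm_idr.
by exists (functor_of_graph_map fcC pmC xM).
Qed.

Lemma groupoid_pointed : pointed C -> pointed (Grpd C).
Proof.
move=> [Z [Zi Zt]]; exists (discrete_groupoid Z); split=> G.
- have [x [_ xu]] := Zi (gob G).
  have [F [F0 F1]] := discrete_groupoid_map x.
  exists (F : hom (discrete_groupoid Z : Grpd C) G); split=> // F' _.
  apply: internal_functor_eq; first by rewrite F0; apply: xu.
  by have [y [_ yu]] := Zi (garr G); rewrite -(yu (farr F)) // (yu (farr F')).
- have [x [_ xu]] := Zt (gob G); have [y [_ yu]] := Zt (garr G).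
  have yM : is_graph_map (X := graph_of G) (Y := graph_of (discrete_groupoid Z)) x y.
    split=> /=; rewrite ?compm_idl -?(yu (x ∘ gdom G)) -?(yu (x ∘ gcod G)) //.
    by rewrite -(xu (y ∘ gid G)).
  exists (functor_of_graph_map fcC pmC yM : hom (G : Grpd C) (discrete_groupoid Z)).
  by split=> // F _; apply: internal_functor_eq; rewrite /= ?(xu (fob F)) ?(yu (farr F)).
Qed.

Hypothesis cpC : has_binary_coproducts C.

(** The reflection has the objects of X. Its arrows are the pushout, along the
    codiagonal of X1 + X1, of the cover of the composable pairs by X1 + X1 that
    sends f to (f, 1) and g to (1, g), where X1 is the object of arrows of X. This
    is the universal quotient of X1 in which composable pairs can be multiplied so
    that (f, 1) goes to f and (1, g) to g. *)
Lemma groupoid_reflection (X : rgraph C) :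
  exists (G : groupoid C) (f0 : hom (robj X) (gob G)) (f1 : hom (rarr X) (garr G)),
    is_graph_map (Y := graph_of G) f0 f1 /\
    forall (H : groupoid C) h0 h1, is_graph_map (X := X) (Y := graph_of H) h0 h1 ->
      exists! F : internal_functor G H, fob F ∘ f0 = h0 /\ farr F ∘ f1 = h1.
Proof.
have [P [p1 [p2 pb]]] := finitely_complete_pullback fcC (rcod X) (rdom X).
have [l [r sp]] := split_pullback_sections pb (rcod_id X) (rdom_id X).
have [S [i [j cp]]] := cpC (rarr X) (rarr X).
have [w [wi wj]] := coproduct_copair l r cp.
have [n [ni nj]] := coproduct_copair (idm _) (idm _) cp.
have wR := split_pullback_cover pmC sp exC wi wj.
have [K [k1 [k2 kK]]] := finitely_complete_pullback fcC w w.
have [A [q qC]] := coequalizers exC pmC (n ∘ k1) (n ∘ k2) cpC.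
have qR : is_regular_epi q by exists K, (n ∘ k1), (n ∘ k2).
have [|m mw] := regular_epi_desc (h := q ∘ n) wR kK.
  by rewrite -!compmA qC.1.
have ml : m ∘ l = q by rewrite -wi compmA mw -compmA ni compm_idr.
have mr : m ∘ r = q by rewrite -wj compmA mw -compmA nj compm_idr.
have [|d dq] := coequalizer_desc (h := rdom X) qC.
  suff dn : rdom X ∘ n = rdom X ∘ p1 ∘ w by rewrite !compmA dn -!compmA kK.1.
  apply: (coproduct_ext cp); rewrite -!compmA ?ni ?nj ?wi ?wj.
    by rewrite (split_pl sp).
  by rewrite (split_pr sp) (comp_preid _ (rdom_id X)) compm_idr.
have [|c cq] := coequalizer_desc (h := rcod X) qC.
  suff cn : rcod X ∘ n = rcod X ∘ p2 ∘ w by rewrite !compmA cn -!compmA kK.1.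
  apply: (coproduct_ext cp); rewrite -!compmA ?ni ?nj ?wi ?wj.
    by rewrite (split_ql sp) (comp_preid _ (rcod_id X)) compm_idr.
  by rewrite (split_qr sp).
have de : d ∘ (q ∘ rid X) = idm _ by rewrite compmA dq rdom_id.
have ce : c ∘ (q ∘ rid X) = idm _ by rewrite compmA cq rcod_id.
have qM : is_graph_map (X := X) (Y := RGraph de ce) (idm _) q.
  by split; rewrite /= ?compm_idl ?compm_idr.
have [M] := quotient_multiplication exC pmC qM qR sp ml mr.
exists (groupoid_of_multiplication fcC pmC M), (idm _), q; split=> //.
move=> H h0 h1 hM; have [hd hc he] := hM.
have [l' [r' [sp' ml' mr']]] := groupoid_sections H.
have [|v [v1 v2]] := pullback_lift (a := h1 ∘ p1) (b := h1 ∘ p2) (split_pb sp').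
  by rewrite !compmA hc hd -!compmA pb.1.
have hn : h1 ∘ n = gmul H ∘ v ∘ w.
  apply: (coproduct_ext cp); rewrite -!compmA ?ni ?nj ?wi ?wj compm_idr.
  - by rewrite (split_pullback_map_left sp sp' v1 v2 hc he) (comp_preid _ ml').
  - by rewrite (split_pullback_map_right sp sp' v1 v2 hd he) (comp_preid _ mr').
have [|u uq] := coequalizer_desc (h := h1) qC.
  by rewrite !compmA hn -!compmA kK.1.
have uM : is_graph_map (X := graph_of (groupoid_of_multiplication fcC pmC M))
    (Y := graph_of H) h0 u.
  split=> /=; last by rewrite compmA uq.
    by apply: (coequalizer_epi qC); rewrite -!compmA uq dq.
  by apply: (coequalizer_epi qC); rewrite -!compmA uq cq.
exists (functor_of_graph_map fcC pmC uM); split=> [|F [F0 F1]].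
  by rewrite /= compm_idr.
apply: internal_functor_eq; first by rewrite /= -F0 compm_idr.
by apply: (coequalizer_epi qC); rewrite F1 uq.
Qed.

(** The reflection of the coproduct of the underlying reflexive graphs. *)
Lemma groupoid_coproducts : has_binary_coproducts (Grpd C).
Proof.
move=> G H.
have [S0 [i0 [j0 cp0]]] := cpC (gob G) (gob H).
have [S1 [i1 [j1 cp1]]] := cpC (garr G) (garr H).
have [d [di dj]] := coproduct_copair (i0 ∘ gdom G) (j0 ∘ gdom H) cp1.
have [c [ci cj]] := coproduct_copair (i0 ∘ gcod G) (j0 ∘ gcod H) cp1.
have [e [ei ej]] := coproduct_copair (i1 ∘ gid G) (j1 ∘ gid H) cp0.
have de : d ∘ e = idm _.
  apply: (coproduct_ext cp0); rewrite -compmA ?ei ?ej compmA ?di ?dj -compmA;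
    by rewrite gdom_id compm_idr compm_idl.
have ce : c ∘ e = idm _.
  apply: (coproduct_ext cp0); rewrite -compmA ?ei ?ej compmA ?ci ?cj -compmA;
    by rewrite gcod_id compm_idr compm_idl.
have [K [f0 [f1 [[fd fc fe] fu]]]] := groupoid_reflection (RGraph de ce).
rewrite /= in fd fc fe.
have iM : is_graph_map (X := graph_of G) (Y := graph_of K) (f0 ∘ i0) (f1 ∘ i1).
  split; rewrite /= ?compmA ?fd ?fc -!compmA ?di ?ci // -ei.
  by rewrite !compmA fe.
have jM : is_graph_map (X := graph_of H) (Y := graph_of K) (f0 ∘ j0) (f1 ∘ j1).
  split; rewrite /= ?compmA ?fd ?fc -!compmA ?dj ?cj // -ej.
  by rewrite !compmA fe.
exists K, (functor_of_graph_map fcC pmC iM : hom (G : Grpd C) K),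
  (functor_of_graph_map fcC pmC jM : hom (H : Grpd C) K).
move=> L a b.
have [h0 [h0i h0j]] := coproduct_copair (fob a) (fob b) cp0.
have [h1 [h1i h1j]] := coproduct_copair (farr a) (farr b) cp1.
have [|F [[F0 F1] Fu]] := fu L h0 h1.
  split=> /=.
  - apply: (coproduct_ext cp1); rewrite -!compmA ?h1i ?h1j ?di ?dj compmA;
      by rewrite ?h0i ?h0j fun_dom.
  - apply: (coproduct_ext cp1); rewrite -!compmA ?h1i ?h1j ?ci ?cj compmA;
      by rewrite ?h0i ?h0j fun_cod.
  - apply: (coproduct_ext cp0); rewrite -!compmA ?h0i ?h0j ?ei ?ej compmA;
      by rewrite ?h1i ?h1j fun_id.
exists (F : hom (K : Grpd C) L); split.
  by split; apply: internal_functor_eq; rewrite /= compmA ?F0 ?F1.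
move=> F' [ea eb]; apply: Fu; split.
  apply: (coproduct_ext cp0); rewrite ?h0i ?h0j -compmA.
    by rewrite -ea.
  by rewrite -eb.
apply: (coproduct_ext cp1); rewrite ?h1i ?h1j -compmA.
  by rewrite -ea.
by rewrite -eb.
Qed.

End Grpd.

Lemma groupoid_semi_abelian (C : category) :
  semi_abelian C -> semi_abelian (Grpd C).
Proof.
move=> [ptC exC pmC cpC]; have [fcC _ _ _] := exC.
have Ulim := groupoid_lifts_limits exC pmC.
have Uiso := groupoid_jointly_conservative exC pmC.
have Uquot := groupoid_lifts_quotients exC pmC.
split.
- exact: groupoid_pointed.
- exact: (transfer_exact Ulim Uiso Uquot exC).
- exact: (transfer_protomodular Ulim Uiso pmC).
- exact: groupoid_coproducts.
Qed.

(** * Internal 2-groupoids *)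

Definition subcategory_inclusion (C : category) (S : C -> Prop) :
    functor (full_subcategory S) C :=
  @Functor (full_subcategory S) C (fun X => sval X) (fun X Y f => f)
    (fun=> erefl) (fun _ _ _ _ _ => erefl).

Lemma full_subcategory_limit (C : category) (S : C -> Prop) (Q : graph)
    (D : diagram Q (full_subcategory S)) (L : full_subcategory S)
    (t : forall v, hom L (dob D v)) :
  is_limit (D := map_diagram (subcategory_inclusion S) D) (X := sval L) t ->
  is_limit t.
Proof.
by move=> tL; apply: is_limit_intro; [exact: tL.1|
  move=> Y u w; apply: (limit_ext tL)|move=> Y s; apply: (limit_lift tL)].
Qed.

Lemma full_subcategory_coequalizer (C : category) (S : C -> Prop)
    (A B Y : full_subcategory S) (f g : hom A B) (q : hom B Y) :
  is_coequalizer (C := C) (A := sval A) (B := sval B) (Y := sval Y) f g q ->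
  is_coequalizer f g q.
Proof.
by move=> qC; apply: is_coequalizer_intro; [exact: qC.1|
  move=> X a b; apply: (coequalizer_epi qC)|
  move=> X h; apply: (coequalizer_desc qC)].
Qed.

(** Left adjoints preserve coproducts: the coproduct in the subcategory is the
    reflection of the one in C. *)
Lemma reflective_coproducts (C : category) (S : C -> Prop) :
  has_binary_coproducts C ->
  (forall X : C, exists Y (eta : hom X Y), S Y /\
     forall T (f : hom X T), S T -> exists! g, g ∘ eta = f) ->
  has_binary_coproducts (full_subcategory S).
Proof.
move=> cpC refl [A SA] [B SB].
have [P [i [j cp]]] := cpC A B.
have [Y [eta [SY etau]]] := refl P.
exists (exist _ Y SY), (eta ∘ i), (eta ∘ j) => -[T ST] f g.
have [h [hi hj]] := coproduct_copair (f : hom A T) (g : hom B T) cp.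
have [u [ue uu]] := etau T h ST.
exists u; split=> [|v [/= vi vj]].
  by split; rewrite /= compmA ue.
apply: uu; apply: (coproduct_ext cp).
  by rewrite hi -compmA vi.
by rewrite hj -compmA vj.
Qed.

Section TwoGroupoids.
Variables (C : category) (saC : semi_abelian C).

Let exC : exact C. Proof. by case: saC. Qed.
Let pmC : protomodular C. Proof. by case: saC. Qed.
Let cpC : has_binary_coproducts C. Proof. by case: saC. Qed.

Let saE : semi_abelian (Grpd C). Proof. exact: groupoid_semi_abelian. Qed.
Let exE : exact (Grpd C). Proof. by case: saE. Qed.
Let pmE : protomodular (Grpd C). Proof. by case: saE. Qed.
Let cpE : has_binary_coproducts (Grpd C). Proof. by case: saE. Qed.
Let fcE : finitely_complete (Grpd C). Proof. by case: exE. Qed.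

Let saD : semi_abelian (DoubleGrpd C). Proof. exact: groupoid_semi_abelian. Qed.
Let exD : exact (DoubleGrpd C). Proof. by case: saD. Qed.
Let fcD : finitely_complete (DoubleGrpd C). Proof. by case: exD. Qed.

(** The endomorphism e^0 d^0 of C^0_1. *)
Definition horizontal_idempotent (D : DoubleGrpd C) :
    hom (gob (garr D)) (gob (garr D)) :=
  horizontal_identity D ∘ fob (gdom D).

Lemma horizontal_isoP (D : DoubleGrpd C) :
  is_iso (horizontal_identity D) <-> horizontal_idempotent D = idm _.
Proof.
have de : fob (gdom D) ∘ horizontal_identity D = idm _ := congr1 fob (gdom_id D).
split=> [[g [ge eg]]|ed]; last by exists (fob (gdom D)).
rewrite -[LHS]compm_idr -eg /horizontal_idempotent -compmA.
by rewrite (comp_preid _ de).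
Qed.

Lemma horizontal_idempotent_natural (D T : DoubleGrpd C) (F : hom D T) :
  horizontal_idempotent T ∘ fob (farr F) = fob (farr F) ∘ horizontal_idempotent D.
Proof.
have e1 : fob (farr F) ∘ horizontal_identity D
    = horizontal_identity T ∘ fob (fob F) := congr1 fob (fun_id F).
have e2 : fob (gdom T) ∘ fob (farr F) = fob (fob F) ∘ fob (gdom D) :=
  congr1 fob (fun_dom F).
by rewrite /horizontal_idempotent -compmA e2 !compmA e1.
Qed.

Lemma horizontal_dom_cod (D : DoubleGrpd C) :
  horizontal_idempotent D = idm _ -> fob (gcod D) = fob (gdom D).
Proof.
move=> ed; have ce : fob (gcod D) ∘ horizontal_identity D = idm _ :=
  congr1 fob (gcod_id D).
by rewrite -[LHS]compm_idr -ed (comp_preid _ ce).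
Qed.

Let limD := groupoid_lifts_limits exE pmE.
Let limE := groupoid_lifts_limits exC pmC.

(* The object C^0_1 of horizontal arrows depends functorially on the double
   groupoid, and as such preserves finite limits and regular epimorphisms. *)
Let limit_horizontal (Q : graph) (D : diagram Q (DoubleGrpd C)) L
    (t : forall v, hom L (dob D v)) : is_limit t ->
  is_limit (D := map_diagram (grpd_ob C) (map_diagram (grpd_arr (Grpd C)) D))
    (fun v => fob (farr (t v))).
Proof. by move=> /(fmap_limit limD false) /(fmap_limit limE true). Qed.

Lemma regular_epi_fob (A B : Grpd C) (q : hom A B) :
  is_regular_epi q -> is_regular_epi (fob q).
Proof.
exact: (fmap_regular_epi limE (groupoid_lifts_quotients exC pmC) exC true).
Qed.

Lemma regular_epi_horizontal (A B : DoubleGrpd C) (q : hom A B) :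
  is_regular_epi q -> is_regular_epi (fob (farr q)).
Proof.
move=> qR; apply: regular_epi_fob.
exact: (fmap_regular_epi limD (groupoid_lifts_quotients exE pmE) exE false qR).
Qed.

Let incl (_ : unit) : functor (TwoGrpd C) (DoubleGrpd C) :=
  subcategory_inclusion (fun D : DoubleGrpd C => is_iso (horizontal_identity D)).

Lemma two_groupoid_lifts_limits : lifts_limits incl.
Proof.
move=> Q D; have [L [t tL]] := fcD (map_diagram (incl tt) D).
have SL : is_iso (horizontal_identity L).
  apply/horizontal_isoP; apply: (limit_ext (limit_horizontal tL)) => v.
  rewrite -horizontal_idempotent_natural compm_idr.
  by rewrite (iffLR (horizontal_isoP _) (svalP (dob D v))) compm_idl.
exists (exist _ L SL : TwoGrpd C), t; split; last by case.
exact: (@full_subcategory_limit _ _ Q D (exist _ L SL) t tL).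
Qed.

Lemma two_groupoid_lifts_quotients : lifts_quotients incl.
Proof.
move=> A R r1 r2 Y q _ /(_ tt) qC.
have SY : is_iso (horizontal_identity (Y tt)).
  have qR : is_regular_epi (q tt) by exists (sval R), r1, r2.
  apply/horizontal_isoP; apply: (regular_epi_epi (regular_epi_horizontal qR)).
  rewrite horizontal_idempotent_natural compm_idl.
  by rewrite (iffLR (horizontal_isoP _) (svalP A)) compm_idr.
exists (exist _ (Y tt) SY : TwoGrpd C), (q tt); split; last by case.
exact: (@full_subcategory_coequalizer _ _ R A (exist _ (Y tt) SY) r1 r2 (q tt) qC).
Qed.

Lemma two_groupoid_pointed : pointed (TwoGrpd C).
Proof.
have [[Z [Zi Zt]] _ _ _] := saD.
pose Q := @Graph void void id id.
pose D := @Diagram Q (DoubleGrpd C) (fun v => match v with end)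
  (fun e => match e with end).
have ZL : is_limit (D := D) (fun v : void => match v return hom Z (dob D v) with end).
  split=> [[]|Y s _]; have [z [_ zu]] := Zt Y.
  by exists z; split=> [[]|w _]; apply: zu.
(* Z is the limit of the empty diagram, and so is its object C^0_1; hence any two
   endomorphisms of the latter are equal. *)
have SZ : is_iso (horizontal_identity Z).
  by apply/horizontal_isoP; apply: (limit_ext (limit_horizontal ZL)) => -[].
by exists (exist _ Z SZ); split=> -[X SX]; [apply: Zi|apply: Zt].
Qed.

(** This is the coequalizer of the two functors from the discrete groupoid on K
    that x and y determine: as all arrows of the latter are identities, a functor
    out of A coequalizes them as soon as it does so on objects. *)
Lemma groupoid_object_quotient (A : Grpd C) K (x y : hom K (gob A)) :
  exists (B : Grpd C) (q : hom A B),
    [/\ is_regular_epi q, fob q ∘ x = fob q ∘ y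
      & forall (T : Grpd C) (f : hom A T), fob f ∘ x = fob f ∘ y ->
          exists g, g ∘ q = f].
Proof.
have [F [F0 F1]] := discrete_groupoid_map exC pmC x.
have [G [G0 G1]] := discrete_groupoid_map exC pmC y.
pose F' : hom (discrete_groupoid K : Grpd C) A := F.
pose G' : hom (discrete_groupoid K : Grpd C) A := G.
have [B [q qC]] := coequalizers exE pmE F' G' cpE.
exists B, q; split; first by exists (discrete_groupoid K), F', G'.
  by have := congr1 fob qC.1; rewrite /= F0 G0.
move=> T f fxy; apply: (coequalizer_desc qC); apply: internal_functor_eq => /=.
  by rewrite F0 G0.
by rewrite F1 G1 !compmA fun_id -!compmA fxy.
Qed.

(** In a 2-groupoid d^0 = c^0 and e^0 d^0 = 1 = e^0 c^0. The reflection imposes the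
    former on the groupoid C^1_0 => C^0_0 and the latter on C^1_1 => C^0_1, by
    universal quotients; the resulting quotient of the horizontal reflexive graph
    is again a groupoid by [quotient_multiplication]. *)
Lemma two_groupoid_reflection (D : DoubleGrpd C) :
  exists (T : DoubleGrpd C) (eta : hom D T), is_iso (horizontal_identity T) /\
    forall (T' : DoubleGrpd C) (f : hom D T'), is_iso (horizontal_identity T') ->
      exists! g, g ∘ eta = f.
Proof.
pose d0 := fob (gdom D); pose c0 := fob (gcod D); pose e0 := fob (gid D).
have de0 : d0 ∘ e0 = idm _ := congr1 fob (gdom_id D).
have ce0 : c0 ∘ e0 = idm _ := congr1 fob (gcod_id D).
have [A [p [pR pdc pu]]] := groupoid_object_quotient d0 c0.
(* Coequalizing x and y imposes the two equations e^0 d^0 = 1 and e^0 c^0 = 1 at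
   once. *)
have [S [i [j cp]]] := cpC (gob (garr D)) (gob (garr D)).
have [x [xi xj]] := coproduct_copair (idm _) (idm _) cp.
have [y [yi yj]] := coproduct_copair (e0 ∘ d0) (e0 ∘ c0) cp.
have xyP X (f : hom (gob (garr D)) X) :
    f ∘ x = f ∘ y <-> f ∘ (e0 ∘ d0) = f /\ f ∘ (e0 ∘ c0) = f.
  split=> [fxy|[fd fc]].
    by split; rewrite -?yi -?yj compmA -fxy -compmA ?xi ?xj compm_idr.
  by apply: (coproduct_ext cp); rewrite -!compmA ?xi ?xj ?yi ?yj compm_idr.
have [B [q [qR qxy qu]]] := groupoid_object_quotient x y.
have [qd qc] := iffLR (xyP _ _) qxy.
have [|d dq] := qu _ (p ∘ gdom D).
  apply/xyP; split; rewrite /= -/d0 -compmA (comp_preid _ de0) //.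
have [|c cq] := qu _ (p ∘ gcod D).
  by apply/xyP; split; rewrite /= -/c0 -compmA (comp_preid _ ce0).
have [|e ep] := pu _ (q ∘ gid D).
  by rewrite /= -/e0 -!compmA qd qc.
have de : d ∘ e = idm _.
  apply: (regular_epi_epi pR).
  by rewrite -compmA ep compmA dq -compmA gdom_id compm_idr compm_idl.
have ce : c ∘ e = idm _.
  apply: (regular_epi_epi pR).
  by rewrite -compmA ep compmA cq -compmA gcod_id compm_idr compm_idl.
have [l [r [sp ml mr]]] := groupoid_sections D.
have pqM : is_graph_map (X := graph_of D) (Y := RGraph de ce) p q by split.
have [||M] := quotient_multiplication exE pmE (Y := RGraph de ce)
    (m := q ∘ gmul D) pqM qR sp.
- by rewrite -compmA ml compm_idr.
- by rewrite -compmA mr compm_idr.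
pose T : DoubleGrpd C := groupoid_of_multiplication fcE pmE M.
pose eta : hom D T := functor_of_graph_map fcE pmE (H := T) pqM.
exists T, eta; split.
  apply/horizontal_isoP; apply: (regular_epi_epi (regular_epi_fob qR)).
  by rewrite (horizontal_idempotent_natural eta) compm_idl.
move=> T' f /horizontal_isoP T'2.
have fed : fob (farr f) ∘ (e0 ∘ d0) = fob (farr f).
  by rewrite -(horizontal_idempotent_natural f) T'2 compm_idl.
have fd : fob (gdom T') ∘ fob (farr f) = fob (fob f) ∘ d0 := congr1 fob (fun_dom f).
have fc : fob (gcod T') ∘ fob (farr f) = fob (fob f) ∘ c0 := congr1 fob (fun_cod f).
have fe : fob (farr f) ∘ e0 = fob (gid T') ∘ fob (fob f) := congr1 fob (fun_id f).
have fdc : fob (fob f) ∘ d0 = fob (fob f) ∘ c0.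
  by rewrite -fd -fc horizontal_dom_cod.
have [g0 g0E] := pu _ (fob f) fdc.
have [|g1 g1E] := qu _ (farr f).
  by apply/xyP; split=> //; rewrite compmA fe -compmA -fdc compmA -fe -compmA.
have gM : is_graph_map (X := graph_of T) (Y := graph_of T') g0 g1.
  split=> /=.
  - by apply: (regular_epi_epi qR); rewrite -!compmA g1E dq compmA g0E fun_dom.
  - by apply: (regular_epi_epi qR); rewrite -!compmA g1E cq compmA g0E fun_cod.
  - by apply: (regular_epi_epi pR); rewrite -!compmA g0E ep compmA g1E fun_id.
exists (functor_of_graph_map fcE pmE gM : hom T T'); split.
  by apply: internal_functor_eq.
move=> g ge; apply: internal_functor_eq => /=.
  by apply: (regular_epi_epi pR); rewrite g0E -ge.
by apply: (regular_epi_epi qR); rewrite g1E -ge.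
Qed.

Lemma two_groupoid_semi_abelian : semi_abelian (TwoGrpd C).
Proof.
have Uiso : jointly_conservative incl.
  by move=> X Y f /(_ tt).
have Uquot := two_groupoid_lifts_quotients.
have Ulim := two_groupoid_lifts_limits.
have [_ _ pmD cpD] := saD; split.
- exact: two_groupoid_pointed.
- exact: (transfer_exact Ulim Uiso Uquot exD).
- exact: (transfer_protomodular Ulim Uiso pmD).
- exact: (reflective_coproducts cpD two_groupoid_reflection).
Qed.

End TwoGroupoids.

Theorem corollary4p2 (C : category) :
  semi_abelian C -> semi_abelian (TwoGrpd C).
Proof. exact: two_groupoid_semi_abelian. Qed.
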